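(* Let $u$ be the fundamental representation of $A_u(I_2)$. The coefficients of the representation $r_{\beta\alpha}=\bar u\otimes u-1$ of $A_u(I_2)$ commute, and generate a $C^*$-subalgebra of $A_u(I_2)$ equal to (i.e. isomorphic to) $C(SO(3))$. The same holds for the coefficients of $r_{\alpha\beta}=u\otimes\bar u-1$.
   Context: $A_u(I_2)$ is the universal $C^*$-algebra generated by variables $u_{ij}$ ($1\le i,j\le 2$) with the relations making unitary both matrices $u=(u_{ij})$ and $\bar u=(u_{ij}^* )$. It is a compact matrix quantum group (Woronowicz), with comultiplication $\delta(u_{ij})=\sum_k u_{ik}\otimes u_{kj}$. A representation is an invertible matrix $r$ over the algebra with $\delta(r_{ij})=\sum_l r_{il}\otimes r_{lj}$, and its coefficients are the linear combinations of its entries. For representations $r,s$, $r\otimes s=\sum e_{ij}\otimes e_{kl}\otimes r_{ij}s_{kl}$. The trivial representation $1$ is contained in $\bar u\otimes u$ and in $u\otimes\bar u$ with multiplicity one; $\bar u\otimes u-1$ and $u\otimes\bar u-1$ denote the (3-dimensional) complementary subrepresentations. *)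

(* Defs.v *)
From HB Require Import structures.
From mathcomp Require Import all_boot all_order all_algebra.
From mathcomp Require Import complex mxtens.
From mathcomp Require Import all_classical all_reals all_analysis.

Set Implicit Arguments.
Unset Strict Implicit.
Unset Printing Implicit Defensive.

Import Order.TTheory GRing.Theory Num.Theory.
Import numFieldNormedType.Exports.

Local Open Scope classical_set_scope.
Local Open Scope ring_scope.
Local Open Scope complex_scope.

(* Unital complex C*-algebras.  The norm is a function of its own because the
   library has no structure joining normed modules and algebras. *)
HB.mixin Record isCStar (R : realType) A & GRing.Algebra R[i] A := {
  star : A -> A;
  cnorm : A -> R;
  starK : involutive star;
  starD : forall a b : A, star (a + b) = star a + star b;
  starZ : forall (k : R[i]) (a : A), star (k *: a) = Num.conj k *: star a;
  starM : forall a b : A, star (a * b) = star b * star a;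
  cnorm_eq0 : forall a : A, cnorm a = 0 -> a = 0;
  cnormZ : forall (k : R[i]) (a : A), cnorm (k *: a) = Normc.normc k * cnorm a;
  ler_cnormD : forall a b : A, cnorm (a + b) <= cnorm a + cnorm b;
  ler_cnormM : forall a b : A, cnorm (a * b) <= cnorm a * cnorm b;
  cnorm_starM : forall a : A, cnorm (star a * a) = cnorm a ^+ 2;
  cnorm_complete : forall v : nat -> A,
    (forall e : R, 0 < e -> exists N : nat, forall m n : nat,
      (N <= m)%N -> (N <= n)%N -> cnorm (v m - v n) < e) ->
    exists l : A, cnorm (v n - l) @[n --> \oo] --> (0 : R)
}.

#[short(type="cstarAlgType")]
HB.structure Definition CStarAlgebra (R : realType) :=
  {A of GRing.Algebra R[i] A & isCStar R A}.

Section CStarTheory.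
Variable R : realType.
Implicit Types A B T : cstarAlgType R.

Definition cnorm_closure A (X : set A) : set A :=
  [set a | forall e : R, 0 < e -> exists2 b, X b & cnorm (a - b) < e].

Definition star_morphism A B (f : A -> B) :=
  forall a, f (star a) = star (f a).

(* Entrywise adjoint: this is the conjugate matrix, not the adjoint one. *)
Definition conj_mx A m n (v : 'M[A]_(m, n)) : 'M[A]_(m, n) := map_mx star v.

Definition unitary_mx A n (v : 'M[A]_n) : Prop :=
  v *m (conj_mx v)^T = 1%:M /\ (conj_mx v)^T *m v = 1%:M.

Definition scalar_emb A n (S : 'M[R[i]]_n) : 'M[A]_n :=
  map_mx (fun c : R[i] => c%:A) S.

(* [A], with the matrix [u], is the universal C*-algebra A_u(I_n). *)
Definition is_Au n A (u : 'M[A]_n) : Prop :=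
  [/\ unitary_mx u,
      unitary_mx (conj_mx u)
    & forall (B : cstarAlgType R) (v : 'M[B]_n),
        unitary_mx v -> unitary_mx (conj_mx v) ->
        exists f : {lrmorphism A -> B},
          [/\ star_morphism f, map_mx f u = v
            & forall g : {lrmorphism A -> B},
                star_morphism g -> map_mx g u = v -> g =1 f]].

Definition tensor_sum A B T (i1 : A -> T) (i2 : B -> T) (s : seq (A * B)) : T :=
  \sum_(p <- s) i1 p.1 * i2 p.2.

(* [T] is a completion of the algebraic tensor product of [A] and [B] for some
   C*-norm, [i1] and [i2] being a |-> a (x) 1 and b |-> 1 (x) b. *)
Record is_cstar_tensor A B T
    (i1 : {lrmorphism A -> T}) (i2 : {lrmorphism B -> T}) : Prop := {
  tensor_star1 : star_morphism i1;
  tensor_star2 : star_morphism i2;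
  tensor_comm : forall a b, i1 a * i2 b = i2 b * i1 a;
  tensor_inj : forall n (a : 'I_n -> A) (b : 'I_n -> B),
    (forall c : 'I_n -> R[i], \sum_k c k *: a k = 0 -> forall k, c k = 0) ->
    \sum_k i1 (a k) * i2 (b k) = 0 -> forall k, b k = 0;
  tensor_dense : cnorm_closure (range (tensor_sum i1 i2)) = [set: T]
}.

(* The minimal (spatial) tensor product: the one with the least C*-norm. *)
Definition is_min_tensor A B T
    (i1 : {lrmorphism A -> T}) (i2 : {lrmorphism B -> T}) : Prop :=
  is_cstar_tensor i1 i2 /\
  forall (T' : cstarAlgType R)
         (j1 : {lrmorphism A -> T'}) (j2 : {lrmorphism B -> T'}),
    is_cstar_tensor j1 j2 ->
    forall s, cnorm (tensor_sum i1 i2 s) <= cnorm (tensor_sum j1 j2 s).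

Section Representations.
Variables (A T : cstarAlgType R) (i1 i2 delta : {lrmorphism A -> T}).

Definition comultiplicative n (r : 'M[A]_n) : Prop :=
  forall i j, delta (r i j) = \sum_l i1 (r i l) * i2 (r l j).

(* The comultiplication of the compact matrix quantum group (A, u). *)
Definition is_comultiplication n (u : 'M[A]_n) : Prop :=
  star_morphism delta /\ comultiplicative u.

Definition representation n (r : 'M[A]_n) : Prop :=
  comultiplicative r /\ exists s, r *m s = 1%:M /\ s *m r = 1%:M.

(* [r] is w - 1: w is equivalent to the direct sum of the trivial
   representation and [r]. *)
Definition is_minus_trivial n (w : 'M[A]_(1 + n)) (r : 'M[A]_n) : Prop :=
  representation r /\
  exists2 S : 'M[R[i]]_(1 + n), S \in unitmx &
    w *m scalar_emb A S = scalar_emb A S *m block_mx 1%:M 0 0 r.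

End Representations.

Definition coefficients A n (r : 'M[A]_n) : set A :=
  [set a | exists c : 'M[R[i]]_n, a = \sum_i \sum_j c i j *: r i j].

Definition cstar_subalgebra A (B : set A) : Prop :=
  cnorm_closure B `<=` B /\
  [/\ B 0,
      forall a b, B a -> B b -> B (a + b),
      forall (k : R[i]) a, B a -> B (k *: a),
      forall a b, B a -> B b -> B (a * b)
    & forall a, B a -> B (star a)].

Definition cstar_generated A (X : set A) : set A :=
  smallest (@cstar_subalgebra A) X.

(* The C*-subalgebra [B] is isomorphic to C(X), the algebra of continuous
   complex functions on the compact space [X] with its pointwise operations.
   Bijective *-morphisms of C*-algebras are isometric. *)
Definition isomorphic_to_C A (B : set A) (X : topologicalType) : Prop :=
  exists phi : A -> X -> R[i],
  [/\ set_bij B [set f : X -> (R[i] : numFieldType) | continuous f] phi,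
      forall a b, B a -> B b -> forall x, phi (a + b) x = phi a x + phi b x,
      forall (k : R[i]) a, B a -> forall x, phi (k *: a) x = k * phi a x,
      forall a b, B a -> B b -> forall x, phi (a * b) x = phi a x * phi b x
    & forall a, B a -> forall x, phi (star a) x = Num.conj (phi a x)].

End CStarTheory.

Definition SO3 (R : realType) : set 'M[R]_3 :=
  [set M | M *m M^T = 1%:M /\ \det M = 1].

Arguments SO3 : clear implicits.

(* Main.v *)
(** Write u = q_0 + i (q_1 sigma_1 + q_2 sigma_2 + q_3 sigma_3).  Unitarity of u
    and of its conjugate says that q_m q_n^* and q_m^* q_n are symmetric in m, n
    and that the q_m^* q_m add up to 1.  Hence the K_mn = q_m^* q_n are
    self-adjoint, commute, and satisfy K_mm K_nl = K_mn K_ml: they obey the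
    relations of the products of the coordinates of a unit quaternion, that is,
    of the matrices of SO(3).  The coefficients of the representation generate
    the same C*-algebra as the K_mn; the unit is obtained from unitarity.

    The isomorphism with C(SO(3)) evaluates at the characters of A_u(I_2) given
    by the elements of SU(2).  It is isometric on polynomials in K:
    a self-adjoint contraction x is (w + w^* ) / 2 for a unitary w, so a
    polynomial of degree d in x has norm at most O(d) times its supremum, and
    taking powers removes the factor.  Iterating over the variables bounds the
    norm by the supremum over a cube, and multiplying by powers of 1 - r / c,
    where r vanishes on the relations, by the supremum over SO(3).
    Surjectivity is the density of polynomials in C(SO(3)). *)

Require Import Defs.
From HB Require Import structures.
From mathcomp Require Import all_boot all_order all_algebra.
From mathcomp Require Import complex mxtens.
From mathcomp Require Import all_classical all_reals all_analysis.
From mathcomp Require Import ring lra.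

Set Implicit Arguments.
Unset Strict Implicit.
Unset Printing Implicit Defensive.

Import Order.TTheory GRing.Theory Num.Theory.
Import numFieldNormedType.Exports.
Local Open Scope ring_scope.

(** Everything rests on one inequality: the norm of a polynomial in the K_mn is at most its supremum
    over SO(3). It is obtained by direct estimates from the C*-identity and completeness, with no
    Gelfand theory or functional calculus; the reverse inequality is the contractivity of
    characters. The q_m are not assumed self-adjoint or commuting, so only the products K_mn can
    play the part of real variables. This also fits SO(3), whose points determine a unit quaternion
    up to sign, and hence its products without ambiguity. The scale [s] that accompanies the K_mn
    brings their norms below 1/2, which makes the equation for z a contraction. The four q_m span
    the same space as the four entries of u, so the K_mn span the same space as the entries of the
    tensor product. Passing from there to r is a scalar change of basis, up to the unit. The second
    assertion is the first one for [conj_mx u], which has the same universal property. *)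

Section CStarBasics.
Variables (R : realType) (A : cstarAlgType R).
Implicit Types (a b : A) (k : R[i]).
Local Notation normc := (@Normc.normc R).

Lemma normc_ge0 k : 0 <= normc k.
Proof. by case: k => x y; rewrite /= sqrtr_ge0. Qed.

Lemma normc_real (x : R) : normc (x%:C)%C = `|x|.
Proof. by rewrite /= expr0n /= addr0 sqrtr_sqr. Qed.

Lemma normc_nat (n : nat) : normc n%:R = n%:R.
Proof.
by rewrite -(rmorph_nat (real_complex R)) normc_real ger0_norm ?ler0n.
Qed.

Lemma normc_opp k : normc (- k) = normc k.
Proof. by case: k => x y; rewrite /= !sqrrN. Qed.

Lemma normc_add k l : normc (k + l) <= normc k + normc l.
Proof. exact: le_normcD. Qed.

Lemma normc_exp k n : normc (k ^+ n) = normc k ^+ n.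
Proof.
elim: n => [|n IH]; first by rewrite !expr0 Normc.normc1.
by rewrite !exprS Normc.normcM IH.
Qed.

Lemma conj_real (x : R) : (((x%:C)%C : R[i])^*)%R = (x%:C)%C.
Proof. by apply/eqP; rewrite eq_complex /= oppr0 !eqxx. Qed.

Lemma conj_i : (('i%C : R[i])^*)%R = - 'i%C.
Proof. by apply/eqP; rewrite eq_complex /= oppr0 !eqxx. Qed.

Lemma star0 : star (0 : A) = 0.
Proof. by rewrite -(scale0r (0 : A)) starZ rmorph0 !scale0r. Qed.

Lemma starN a : star (- a) = - star a.
Proof. by rewrite -scaleN1r starZ rmorphN rmorph1 scaleN1r. Qed.

Lemma starB a b : star (a - b) = star a - star b.
Proof. by rewrite starD starN. Qed.

Lemma star1 : star (1 : A) = 1.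
Proof. by rewrite -[RHS]starK -[star 1 in RHS]mulr1 starM starK mulr1. Qed.

Lemma starX a n : star (a ^+ n) = star a ^+ n.
Proof.
by elim: n => [|n IH]; rewrite ?expr0 ?star1 // exprS starM IH exprSr.
Qed.

Lemma star_alg k : star (k%:A : A) = (k^*)%R%:A.
Proof. by rewrite starZ star1. Qed.

Lemma star_sum (I : Type) (r : seq I) (P : pred I) (F : I -> A) :
  star (\sum_(i <- r | P i) F i) = \sum_(i <- r | P i) star (F i).
Proof. exact: (big_morph _ starD star0). Qed.

Lemma cnorm0 : cnorm (0 : A) = 0.
Proof. by rewrite -(scale0r (0 : A)) cnormZ Normc.normc0 mul0r. Qed.

Lemma cnormN a : cnorm (- a) = cnorm a.
Proof. by rewrite -scaleN1r cnormZ normc_opp Normc.normc1 mul1r. Qed.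

Lemma cnormB_sym a b : cnorm (a - b) = cnorm (b - a).
Proof. by rewrite -cnormN opprB. Qed.

Lemma cnorm_ge0 a : 0 <= cnorm a.
Proof.
have := ler_cnormD a (- a); rewrite subrr cnorm0 cnormN.
by rewrite -mulr2n -mulr_natl pmulr_rge0 ?ltr0n.
Qed.

Lemma ler_cnormB a b : cnorm (a - b) <= cnorm a + cnorm b.
Proof. by rewrite -[cnorm b]cnormN ler_cnormD. Qed.

Lemma cnorm_eq0P a : reflect (a = 0) (cnorm a == 0).
Proof. by apply: (iffP eqP) => [/cnorm_eq0 //|->]; rewrite cnorm0. Qed.

Lemma cnorm_star a : cnorm (star a) = cnorm a.
Proof.
have le_star b : cnorm b <= cnorm (star b).
  have [/cnorm_eq0P ->|b0] := boolP (cnorm b == 0).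
    by rewrite star0.
  have bp : 0 < cnorm b by rewrite lt_def b0 cnorm_ge0.
  rewrite -(ler_pM2r bp) -expr2 -cnorm_starM; exact: ler_cnormM.
by apply/eqP; rewrite eq_le le_star -{2}[a]starK le_star.
Qed.

Lemma cnorm1 : cnorm (1 : A) = 1.
Proof.
have := cnorm_starM (1 : A); rewrite star1 mulr1 expr2 -{1}[cnorm 1]mulr1.
move/mulfI => -> //; apply/negP => /cnorm_eq0P/eqP.
by rewrite oner_eq0.
Qed.

Lemma cnorm_alg k : cnorm (k%:A : A) = normc k.
Proof. by rewrite cnormZ cnorm1 mulr1. Qed.

Lemma ler_cnormX a n : cnorm (a ^+ n) <= cnorm a ^+ n.
Proof.
elim: n => [|n IH]; first by rewrite !expr0 cnorm1.
rewrite !exprS; apply: le_trans (ler_cnormM _ _) _.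
by rewrite ler_wpM2l ?cnorm_ge0.
Qed.

(** For a normal [b] the C*-identity, used for b^2, for [star b * b] and for b, gives ||b^2||^2 =
    ||b||^4. Squaring repeatedly reaches only the powers of two, which is all that the removal of
    constants in [le_of_pow2_le] asks for. *)
Lemma cnorm_normal_pow2 a n : star a * a = a * star a ->
  cnorm (a ^+ (2 ^ n)) = cnorm a ^+ (2 ^ n).
Proof.
move=> na; have nX m : star (a ^+ m) * a ^+ m = a ^+ m * star (a ^+ m).
  by rewrite starX; apply/commrX/commr_sym/commrX/commr_sym.
have sa b : star b = b -> cnorm (b ^+ 2) = cnorm b ^+ 2.
  by move=> hb; rewrite -cnorm_starM hb expr2.
have sq m : cnorm (a ^+ (2 ^ m) ^+ 2) = cnorm (a ^+ (2 ^ m)) ^+ 2.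
  set b := a ^+ _; have nb : star b * b = b * star b := nX _.
  have hb : star (star b * b) = star b * b by rewrite starM starK.
  apply/eqP; rewrite -(eqrXn2 (n := 2)) ?exprn_ge0 ?cnorm_ge0 //.
  by rewrite -[eqbLHS]cnorm_starM starX -exprMn_comm // (sa _ hb) cnorm_starM.
elim: n => [|n IH]; first by rewrite !expr1.
by rewrite expnSr !exprM sq IH.
Qed.

End CStarBasics.

(** * Limits, fixed points and the Neumann series *)

Section Completeness.
Local Open Scope classical_set_scope.
Variables (R : realType) (A : cstarAlgType R).
Implicit Types (a b : A) (X : set A).

Lemma exprn_small (c e : R) : 0 <= c < 1 -> 0 < e ->
  exists N, forall n, (N <= n)%N -> c ^+ n < e.
Proof.
move=> /andP[c0 c1] e0.
have /cvgrPdist_lt /(_ e e0) [N _ HN] : c ^+ n @[n --> \oo] --> (0 : R).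
  by apply: cvg_expr; rewrite ger0_norm.
exists N => n Nn; have := HN n Nn; rewrite /= sub0r normrN ger0_norm //.
exact: exprn_ge0.
Qed.

Lemma le_of_lt_add (x y : R) : (forall e, 0 < e -> x < y + e) -> x <= y.
Proof.
move=> h; rewrite leNgt; apply/negP => yx.
by have := h (x - y); rewrite subr_gt0 addrC subrK ltxx => /(_ yx).
Qed.

Lemma cnorm_limit (v : nat -> A) :
  (forall e : R, 0 < e -> exists N : nat, forall m n : nat,
      (N <= m)%N -> (N <= n)%N -> cnorm (v m - v n) < e) ->
  exists l, forall e : R, 0 < e -> exists N : nat, forall n, (N <= n)%N ->
    cnorm (v n - l) < e.
Proof.
move=> /cnorm_complete[l /cvgrPdist_lt hl]; exists l => e /hl[N _ HN].
exists N => n /HN; rewrite /= sub0r normrN ger0_norm //; exact: cnorm_ge0.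
Qed.

Lemma subset_cnorm_closure X : X `<=` cnorm_closure X.
Proof. by move=> a Xa e e0; exists a; rewrite // subrr cnorm0. Qed.

Lemma cnorm_closureP X a : (forall e : R, 0 < e -> exists2 b, cnorm_closure X b &
  cnorm (a - b) < e) -> cnorm_closure X a.
Proof.
move=> h e e0; have e20 : 0 < e / 2 by rewrite divr_gt0.
have [b Xb ab] := h _ e20; have [c Xc bc] := Xb _ e20; exists c => //.
rewrite (splitr e) -(subrK b a) -addrA.
exact: le_lt_trans (ler_cnormD _ _) (ltrD ab bc).
Qed.

(** Banach's theorem for the distance [cnorm (a - b)]. It is stated on a closed set so that side
    conditions such as self-adjointness pass to the fixed point. *)
Lemma contraction_fixpoint X (f : A -> A) (c : R) a0 :
  0 <= c < 1 -> cnorm_closure X `<=` X -> X a0 ->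
  (forall a, X a -> X (f a)) ->
  (forall a b, X a -> X b -> cnorm (f a - f b) <= c * cnorm (a - b)) ->
  exists2 a, X a & f a = a.
Proof.
move=> /andP[c0 c1] Xcl Xa0 Xf lip; pose v n := iter n f a0.
have Xv n : X (v n) by elim: n => [|n IH] //=; apply: Xf.
pose D := cnorm (v 1%N - v 0%N).
have step n : cnorm (v n.+1 - v n) <= c ^+ n * D.
  elim: n => [|n IH]; first by rewrite expr0 mul1r.
  apply: (le_trans (lip _ _ (Xv n.+1) (Xv n))).
  by rewrite exprS -mulrA ler_wpM2l.
have c1' : 0 < 1 - c by rewrite subr_gt0.
have far n m : cnorm (v (n + m)%N - v n) <= c ^+ n * (D / (1 - c)).
  suff : cnorm (v (n + m)%N - v n) <= c ^+ n * (D / (1 - c)) * (1 - c ^+ m).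
    move/le_trans; apply; rewrite -[leRHS]mulr1 ler_wpM2l //.
      by rewrite !mulr_ge0 ?exprn_ge0 ?cnorm_ge0 ?invr_ge0 // ltW.
    by rewrite gerBl exprn_ge0.
  elim: m => [|m IH]; first by rewrite addn0 subrr cnorm0 expr0 subrr mulr0.
  rewrite addnS -(subrK (v (n + m)%N) (v _)) -addrA.
  apply: le_trans (ler_cnormD _ _) _.
  apply: le_trans (lerD (step _) IH) _.
  rewrite exprD exprS le_eqVlt; apply/orP; left; apply/eqP.
  by field; rewrite lt0r_neq0.
have Dc0 : 0 <= D / (1 - c) by rewrite divr_ge0 ?cnorm_ge0 // ltW.
have [|l hl] := @cnorm_limit v.
  (* The [+ 1] keeps the divisor positive when the first step [D] is zero. *)
  move=> e e0; have e2 : 0 < e / 2 / (D / (1 - c) + 1).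
    by rewrite !divr_gt0 // ltr_wpDl.
  have [|N HN] := @exprn_small c _ _ e2; first by rewrite c0 c1.
  exists N => m n Nm Nn; rewrite -(subrK (v N) (v m)) -addrA (splitr e).
  have aux k : (N <= k)%N -> cnorm (v k - v N) < e / 2.
    move=> Nk; rewrite -(subnKC Nk); apply: le_lt_trans (far _ _) _.
    have := HN N (leqnn N); rewrite ltr_pdivlMr ?ltr_wpDl //.
    by apply: le_lt_trans; rewrite ler_wpM2l ?exprn_ge0 // lerDl.
  apply: le_lt_trans (ler_cnormD _ _) _; apply: ltrD; first exact: aux.
  by rewrite cnormB_sym aux.
have Xl : X l.
  apply: Xcl => e e0; have [N HN] := hl e e0; exists (v N) => //.
  by rewrite cnormB_sym HN.
exists l => //; apply/eqP; rewrite -subr_eq0; apply/eqP/cnorm_eq0/eqP.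
rewrite eq_le cnorm_ge0 andbT; apply: le_of_lt_add => e e0; rewrite add0r.
have [N HN] := hl _ (divr_gt0 e0 (ltr0Sn _ 1)).
rewrite -(subrK (v N.+1) (f l)) -addrA (splitr e).
apply: le_lt_trans (ler_cnormD _ _) _; apply: ltrD; last exact: HN.
apply: le_lt_trans (lip _ _ Xl (Xv N)) _; rewrite cnormB_sym.
apply: le_lt_trans (HN N (leqnn N)); rewrite -[leRHS]mul1r ler_wpM2r //.
  exact: cnorm_ge0.
exact: ltW.
Qed.

(** The inverse is the fixed point of b = 1 + a b. *)
Lemma neumann a : cnorm a < 1 -> exists b, (1 - a) * b = 1.
Proof.
move=> a1; have [|||||b _ hb] := @contraction_fixpoint setT (fun b => 1 + a * b)
  (cnorm a) 0 => //; first by rewrite cnorm_ge0.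
  by move=> b c _ _; rewrite opprD addrACA subrr add0r -mulrBr ler_cnormM.
by exists b; rewrite mulrBl mul1r -{1}hb addrK.
Qed.

End Completeness.

(** * Commutative C*-subalgebras and unitaries in them *)

Section CommutativeSubalgebras.
Local Open Scope classical_set_scope.
Variables (R : realType) (A : cstarAlgType R).
Implicit Types (a b : A) (X C : set A).

Definition comm_cstar_subalgebra C :=
  [/\ cstar_subalgebra C, C 1 & forall a b, C a -> C b -> a * b = b * a].

Definition commutant X : set A := [set a | forall x, X x -> a * x = x * a].

Lemma commutant_closed X : cnorm_closure (commutant X) `<=` commutant X.
Proof.
move=> a ha x Xx; apply/eqP; rewrite -subr_eq0; apply/eqP/cnorm_eq0/eqP.
rewrite eq_le cnorm_ge0 andbT; apply: le_of_lt_add => e e0; rewrite add0r.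
have x1 : 0 < 2 * (cnorm x + 1) by rewrite mulr_gt0 // ltr_wpDl ?cnorm_ge0.
have [b hb ab] := ha _ (divr_gt0 e0 x1).
have -> : a * x - x * a = (a - b) * x - x * (a - b).
  by rewrite mulrBl mulrBr (hb x Xx) opprB addrA subrK.
apply: le_lt_trans (ler_cnormB _ _) _.
apply: le_lt_trans (lerD (ler_cnormM _ _) (ler_cnormM _ _)) _.
rewrite [cnorm x * _]mulrC -mulr2n -mulrnAr -mulr_natl.
move: ab; rewrite ltr_pdivlMr //; apply: le_lt_trans.
by rewrite ler_wpM2l ?cnorm_ge0 // ler_wpM2l // lerDl.
Qed.

Lemma commutant_subalgebra X : (forall x, X x -> X (star x)) ->
  cstar_subalgebra (commutant X).
Proof.
move=> Xs; split; first exact: commutant_closed.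
split=> [x _|a b ha hb x Xx|k a ha x Xx|a b ha hb x Xx|a ha x Xx].
- by rewrite mulr0 mul0r.
- by rewrite mulrDl mulrDr ha // hb.
- by rewrite -scalerAl -scalerAr ha.
- by rewrite -mulrA hb // mulrA ha // mulrA.
- by apply: (can_inj (@starK _ _)); rewrite !starM !starK ha //; apply: Xs.
Qed.

(** The bicommutant works: a commuting set lies in its commutant, so the bicommutant lies in the
    commutant too, and its elements commute with one another. *)
Lemma comm_cstar_subalgebra_ex X : (forall x, X x -> X (star x)) ->
  (forall x y, X x -> X y -> x * y = y * x) ->
  exists2 C, comm_cstar_subalgebra C & X `<=` C.
Proof.
move=> Xs Xc; exists (commutant (commutant X)).
  split; last 2 first.
  - by move=> x _; rewrite mul1r mulr1.
  - move=> a b ha hb; apply: ha => x Xx; apply: hb => y Xy; exact: Xc.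
  apply: commutant_subalgebra => a ha x Xx.
  by apply: (can_inj (@starK _ _)); rewrite !starM !starK ha //; apply: Xs.
by move=> x Xx a ha; rewrite ha.
Qed.

Section Closure.
Variables (C : set A) (hC : comm_cstar_subalgebra C).

Lemma commC_closed : cnorm_closure C `<=` C. Proof. by case: hC => -[]. Qed.
Lemma commC0 : C 0. Proof. by case: hC => -[_ []]. Qed.
Lemma commC1 : C 1. Proof. by case: hC. Qed.
Lemma commCD a b : C a -> C b -> C (a + b).
Proof. by case: hC => -[_ [_ + _ _ _]] _ _; apply. Qed.
Lemma commCZ k a : C a -> C (k *: a).
Proof. by case: hC => -[_ [_ _ + _ _]] _ _; apply. Qed.
Lemma commCM a b : C a -> C b -> C (a * b).
Proof. by case: hC => -[_ [_ _ _ + _]] _ _; apply. Qed.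
Lemma commC_star a : C a -> C (star a).
Proof. by case: hC => -[_ [_ _ _ _ +]] _ _; apply. Qed.
Lemma commC_comm a b : C a -> C b -> a * b = b * a.
Proof. by case: hC => _ _; apply. Qed.
Lemma commCB a b : C a -> C b -> C (a - b).
Proof. by move=> ha hb; rewrite -scaleN1r; apply/commCD/commCZ. Qed.
Lemma commCX a n : C a -> C (a ^+ n).
Proof.
move=> ha; elim: n => [|n IH]; first by rewrite expr0; apply: commC1.
by rewrite exprS; apply: commCM.
Qed.

(* With z = (x^2 + z^2)/2 one has x^2 + (1 - z)^2 = 1, so x + i(1 - z) is
   unitary. *)
Lemma real_part_of_unitary x : C x -> star x = x -> cnorm x <= 2^-1 ->
  exists w, [/\ C w, star w * w = 1 & w + star w = 2%:R *: x].
Proof.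
move=> Cx sx x1; pose f z : A := (2^-1 : R[i]) *: (x ^+ 2 + z ^+ 2).
have n2 : Normc.normc (2^-1 : R[i]) = 2^-1.
  by rewrite Normc.normcV (normc_nat R 2).
have c2 : ((2^-1 : R[i])^*)%R = 2^-1 by rewrite fmorphV rmorph_nat.
have h20 : (0 : R) <= 2^-1 by rewrite invr_ge0.
have h21 : (2^-1 : R) < 1 by rewrite invf_lt1 // ltr1n.
(* On this ball [f] is a contraction with constant 1/2: its elements commute, so a^2 - b^2 = (a -
   b)(a + b), and the second factor has norm at most 1. *)
pose X := [set z | [/\ C z, star z = z & cnorm z <= 2^-1]].
have sq (z : A) : cnorm z <= 2^-1 -> cnorm (z ^+ 2) <= 2^-1.
  move=> hz; apply: le_trans (ler_cnormX _ _) _; rewrite expr2 -[leRHS]mulr1.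
  by apply: ler_pM; rewrite ?cnorm_ge0 // (le_trans hz (ltW h21)).
have [|||||z [Cz sz _] fz] := @contraction_fixpoint R A X f 2^-1 0.
- by rewrite h20.
- move=> a ha; split.
  + by apply: commC_closed => e e0; have [b [Cb _ _] ab] := ha e e0; exists b.
  + apply/eqP; rewrite -subr_eq0; apply/eqP/cnorm_eq0/eqP.
    rewrite eq_le cnorm_ge0 andbT; apply: le_of_lt_add => e e0; rewrite add0r.
    have [b [_ sb _] ab] := ha _ (divr_gt0 e0 (ltr0Sn _ 1)).
    rewrite -(subrK b (star a)) -addrA (splitr e).
    apply: le_lt_trans (ler_cnormD _ _) _.
    by rewrite -{1}sb -starB cnorm_star [cnorm (b - a)]cnormB_sym ltrD.
  + apply: le_of_lt_add => e e0; have [b [_ _ b1] ab] := ha e e0.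
    rewrite -(subrK b a) addrC; apply: le_lt_trans (ler_cnormD _ _) _.
    exact: ler_ltD.
- by split; rewrite ?star0 ?cnorm0 //; apply: commC0.
- move=> z [Cz sz z1]; split.
  + by apply/commCZ/commCD; apply: commCX.
  + by rewrite /f starZ starD !starX sx sz c2.
  + rewrite cnormZ n2 -[leRHS]mulr1 ler_wpM2l //.
    apply: le_trans (ler_cnormD _ _) _; rewrite [leRHS](splitr 1) div1r.
    by rewrite lerD // sq.
- move=> a b [Ca _ a1] [Cb _ b1].
  rewrite /f -scalerBr cnormZ n2 opprD addrACA subrr add0r ler_wpM2l //.
  rewrite subrXX_comm; last exact: commC_comm.
  rewrite !big_ord_recr big_ord0 /= add0r !subnn !expr0 mulr1 mul1r.
  apply: le_trans (ler_cnormM _ _) _.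
  rewrite -[leRHS]mulr1 ler_wpM2l ?cnorm_ge0 //.
  apply: le_trans (ler_cnormD _ _) _; rewrite (splitr 1) div1r lerD //.
pose w := x + 'i%C *: (1 - z); exists w; split.
- by apply/commCD/commCZ/commCB => //; apply: commC1.
- have ii : 'i%C * 'i%C = -1 :> R[i] by rewrite -expr2 sqr_i.
  have xz : x ^+ 2 + z ^+ 2 = z + z.
    have half : 2^-1 + 2^-1 = 1 :> R[i].
      by rewrite -[X in X + _]mul1r -[X in _ + X]mul1r -splitr.
    by rewrite -[in RHS]fz /f -scalerDl half scale1r.
  have xy : x * (1 - z) = (1 - z) * x.
    by apply/commC_comm/commCB => //; apply: commC1.
  rewrite /w starD starZ starB star1 sx sz conj_i mulrDl !mulrDr.
  rewrite -!scalerAl -!scalerAr scalerA mulNr ii opprK scale1r xy scaleNr.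
  rewrite addrA addrK mulrBl mul1r mulrBr mulr1 opprB addrA.
  by rewrite addrACA -!expr2 xz addrACA subrr addr0 addrC subrK.
- rewrite /w starD starZ starB star1 sx sz conj_i scaleNr addrACA subrr addr0.
  by rewrite scaler_nat mulr2n.
Qed.
End Closure.
End CommutativeSubalgebras.

(** * Norm of a polynomial in one self-adjoint element *)

Section OneVariable.
Local Open Scope classical_set_scope.
Variables (R : realType) (A : cstarAlgType R).
Local Notation normc := (@Normc.normc R).

Lemma bernoulli_ineq (h : R) n : 0 <= h -> 1 + n%:R * h <= (1 + h) ^+ n.
Proof.
move=> h0; elim: n => [|n IH]; first by rewrite mul0r addr0 expr0.
rewrite exprS; apply: le_trans (ler_wpM2l _ IH); last by rewrite addr_ge0.
rewrite -natr1 -subr_ge0 (_ : _ - _ = n%:R * h ^+ 2); last by ring.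
by rewrite mulr_ge0 ?exprn_ge0.
Qed.

(** The spurious factor grows only linearly in the exponent 2^k, whereas (y / M)^(2^k) would grow
    exponentially if y exceeded M. *)
Lemma le_of_pow2_le (c y M : R) : 0 <= y -> 0 <= M ->
  (forall k, y ^+ (2 ^ k) <= c * 2 ^+ k * M ^+ (2 ^ k)) -> y <= M.
Proof.
move=> y0 M0 h; have [M00|Mp] := leP M 0.
  have M00' : M = 0 by apply/eqP; rewrite eq_le M00.
  by have := h 0%N; rewrite !expr1 M00' mulr0.
rewrite leNgt; apply/negP => My.
pose e := y / M - 1; have e0 : 0 < e.
  by rewrite subr_gt0 ltr_pdivlMr // mul1r.
have ye : y = (1 + e) * M by rewrite /e addrCA subrr addr0 divfK // gt_eqF.
have key k : 2 ^+ k * e ^+ 2 <= 2 * c.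
  have p0 : (0 : R) < 2 ^+ k by rewrite exprn_gt0.
  (* Bernoulli's bound at 2^k is linear in 2^k and would only match the factor. Squaring it, which
     means using the hypothesis at k + 1, makes it win. *)
  have := h k.+1; rewrite {1}ye exprMn ler_pM2r ?exprn_gt0 // expnSr exprM.
  have := bernoulli_ineq (2 ^ k) (ltW e0); rewrite natrX => b1 b2.
  have b3 : (2 ^+ k * e) ^+ 2 <= ((1 + e) ^+ (2 ^ k)) ^+ 2.
    rewrite ler_sqr ?nnegrE; first by apply: le_trans b1; rewrite lerDr.
      by rewrite mulr_ge0 // ltW.
    by rewrite exprn_ge0 // addr_ge0 // ltW.
  have := le_trans b3 b2.
  have -> : (2 ^+ k * e) ^+ 2 = 2 ^+ k * (2 ^+ k * e ^+ 2) by ring.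
  have -> : c * 2 ^+ k.+1 = 2 ^+ k * (2 * c) by rewrite exprS; ring.
  by rewrite ler_pM2l.
pose n := Num.bound `|2 * c / e ^+ 2|.
have e2 : 0 < e ^+ 2 by rewrite exprn_gt0.
have : 2 * c / e ^+ 2 < 2 ^+ n.
  apply: le_lt_trans (ler_norm _) _.
  apply: lt_trans (archi_boundP (normr_ge0 _)) _.
  by rewrite -natrX ltr_nat ltn_expl.
by rewrite ltr_pdivrMr // ltNge key.
Qed.

Lemma sum_even_odd (V : nmodType) (F : nat -> V) n :
  \sum_(k < n + n) F k = \sum_(k < n) F (k + k)%N + \sum_(k < n) F (k + k).+1.
Proof.
elim: n => [|n IH]; first by rewrite !big_ord0 addr0.
rewrite addSn addnS 2!big_ord_recr /= IH [in RHS]big_ord_recr /=.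
by rewrite [\sum_(k < n.+1) F _.+1]big_ord_recr /= -!addrA; congr (_ + _);
   rewrite addrCA.
Qed.

Lemma unit_sqrt (z : R[i]) : normc z = 1 -> exists2 y, normc y = 1 & y ^+ 2 = z.
Proof.
move=> z1; exists (sqrtC z); last exact: sqrtCK.
apply/eqP; rewrite -(eqrXn2 (n := 2)) ?normc_ge0 //.
by rewrite -normc_exp sqrtCK z1 expr1n.
Qed.

(* Both halves of p(z) = e(z^2) + z o(z^2) are bounded by sup |p| on the
   circle, since e(z^2) and z o(z^2) are the means of p(z) and p(-z) up to
   sign. *)
Lemma circle_bound m (a : nat -> A) (w : A) (M : R) : cnorm w <= 1 ->
  (forall z, normc z = 1 -> cnorm (\sum_(k < 2 ^ m) z ^+ k *: a k) <= M) ->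
  cnorm (\sum_(k < 2 ^ m) a k * w ^+ k) <= 2 ^+ m * M.
Proof.
elim: m a w => [|m IH] a w w1 h.
  have := h 1 (Normc.normc1 R); rewrite !big_ord_recr !big_ord0 /= !add0r.
  by rewrite expr0 scale1r expr0 mulr1 expr0 mul1r.
pose ev k := a (k + k)%N; pose od k := a (k + k).+1.
have w2 : cnorm (w ^+ 2) <= 1.
  by apply: le_trans (ler_cnormX _ _) _; rewrite exprn_ile1 ?cnorm_ge0.
have split_sum (z : R[i]) : \sum_(k < 2 ^ m.+1) z ^+ k *: a k =
    \sum_(k < 2 ^ m) (z ^+ 2) ^+ k *: ev k +
    z *: \sum_(k < 2 ^ m) (z ^+ 2) ^+ k *: od k.
  rewrite expnS mul2n -addnn (sum_even_odd (fun k => z ^+ k *: a k)) scaler_sumr; congr (_ + _).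
    by apply: eq_bigr => k _; rewrite -exprM mul2n -addnn.
  by apply: eq_bigr => k _; rewrite scalerA exprS -exprM mul2n -addnn.
have half z : normc z = 1 ->
    cnorm (\sum_(k < 2 ^ m) (z ^+ 2) ^+ k *: ev k) <= M /\
    cnorm (\sum_(k < 2 ^ m) (z ^+ 2) ^+ k *: od k) <= M.
  move=> z1; have := h z z1; have := h (- z); rewrite normc_opp z1 !split_sum.
  rewrite sqrrN scaleNr; set e := \sum_(k < _) _; set o := \sum_(k < _) _.
  move=> /(_ erefl) h1 h2.
  have two (b : A) : cnorm (b + b) <= M + M -> cnorm b <= M.
    rewrite -mulr2n -scaler_nat cnormZ normc_nat -mulr2n -(mulr_natl M).
    by rewrite ler_pM2l.
  split; first apply: two.
    have -> : e + e = (e + z *: o) + (e - z *: o) by rewrite addrACA subrr addr0.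
    exact: le_trans (ler_cnormD _ _) (lerD h2 h1).
  suff : cnorm (z *: o) <= M by rewrite cnormZ z1 mul1r.
  apply: two.
  have -> : z *: o + z *: o = (e + z *: o) - (e - z *: o).
    by rewrite opprB [_ - e]addrC addrACA subrr add0r.
  exact: le_trans (ler_cnormB _ _) (lerD h2 h1).
have -> : \sum_(k < 2 ^ m.+1) a k * w ^+ k =
    \sum_(k < 2 ^ m) ev k * (w ^+ 2) ^+ k +
    (\sum_(k < 2 ^ m) od k * (w ^+ 2) ^+ k) * w.
  rewrite expnS mul2n -addnn (sum_even_odd (fun k => a k * w ^+ k)) mulr_suml; congr (_ + _).
    by apply: eq_bigr => k _; rewrite -exprM mul2n -addnn.
  by apply: eq_bigr => k _; rewrite -mulrA -exprM -exprSr mul2n -addnn.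
apply: le_trans (ler_cnormD _ _) _.
have -> : 2 ^+ m.+1 * M = 2 ^+ m * M + 2 ^+ m * M by rewrite exprS; ring.
apply: lerD.
  (* [half] bounds the two parts at squares; every point of the circle is the square of a point of
     the circle. *)
  by apply: IH => // z /unit_sqrt[y y1 <-]; have [] := half y y1.
apply: le_trans (ler_cnormM _ _) _; rewrite -[leRHS]mulr1.
apply: ler_pM; rewrite ?cnorm_ge0 //.
by apply: IH => // z /unit_sqrt[y y1 <-]; have [] := half y y1.
Qed.

End OneVariable.

Section PolynomialBound.
Local Open Scope classical_set_scope.
Variables (R : realType) (A : cstarAlgType R).
Local Notation normc := (@Normc.normc R).
Local Notation scal t := ((t%:C)%C%:A).

(* If w is unitary with real part x, then p(x) w^d is a polynomial of degree at
   most 2d in w, by x = (w^2 + 1) w^-1 / 2. *)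
Lemma horner_real_part (p : {poly A}) d N : (size p <= d.+1)%N -> (2 * d < N)%N ->
  exists a : nat -> A, forall w x : A, x * w = w * x -> w ^+ 2 + 1 = 2%:R *: (x * w) ->
    \sum_(k < N) a k * w ^+ k = p.[x] * w ^+ d.
Proof.
(* [r j] represents x^j w^d, written as (x w)^j w^(d - j), as a polynomial in w. *)
move=> sp dN; pose r j : {poly R[i]} := (2^-1 *: ('X^2 + 1%:P)) ^+ j * 'X^(d - j).
have sr j : (j <= d)%N -> (size (r j) <= N)%N.
  move=> jd; apply: leq_trans (size_polyMleq _ _) _.
  rewrite size_polyXn addnS /=.
  have /leq_add/(_ (leqnn (d - j))) := size_poly_exp_leq (2^-1 *: ('X^2 + 1%:P) : {poly R[i]}) j.
  rewrite size_scale ?invr_eq0 ?pnatr_eq0 // size_XnaddC //= => /leq_trans; apply.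
  by apply: leq_trans dN; rewrite addSn ltnS mul2n -addnn mul2n -addnn -addnA
     subnKC // leq_add2r.
exists (fun k => \sum_(j < d.+1) (r j)`_k *: p`_j) => w x xw hw.
rewrite (horner_coef_wide _ sp) mulr_suml.
under eq_bigr => k _ do rewrite mulr_suml.
rewrite exchange_big /=; apply: eq_bigr => j _.
have jd : (j <= d)%N by rewrite -ltnS ltn_ord.
have -> : p`_j * x ^+ j * w ^+ d = p`_j * horner_alg w (r j).
  rewrite /r rmorphM !rmorphXn /= horner_algX linearZ /= rmorphD rmorphXn /=.
  rewrite horner_algX horner_algC scale1r hw mulr_algl scalerA mulVf ?pnatr_eq0 // scale1r.
  by rewrite exprMn_comm // -!mulrA -exprD subnKC.
have -> : horner_alg w (r j) = \sum_(k < N) (r j)`_k *: w ^+ k.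
  rewrite /horner_alg /horner_morph (@horner_coef_wide _ N) ?size_map_poly ?sr //.
  by apply: eq_bigr => k _; rewrite coef_map /= mulr_algl.
by rewrite mulr_sumr; apply: eq_bigr => k _; rewrite -scalerAl -scalerAr.
Qed.

(** The coefficients given by [horner_real_part] do not depend on the pair (x, w). They can
    therefore be tested at scalar pairs (Re z, z) with |z| = 1, where p is bounded by hypothesis,
    and [circle_bound] carries the bound over to the given pair. The factor is linear in the degree:
    2^(s + 2) coefficients cover the degrees up to 2 * 2^s. *)
Lemma horner_bound_weak (p : {poly A}) s (x w : A) M :
  (size p <= (2 ^ s).+1)%N -> x * w = w * x -> star w * w = 1 ->
  w * star w = 1 -> w ^+ 2 + 1 = 2%:R *: (x * w) ->
  (forall t : R, `|t| <= 1 -> cnorm p.[scal t] <= M) ->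
  cnorm p.[x] <= 2 ^+ (s + 2) * M.
Proof.
move=> sp xw w1 w1' hw hM.
have [|a ha] := @horner_real_part p (2 ^ s) (2 ^ (s + 2)) sp.
  by rewrite expnD mulnC ltn_pmul2l ?expn_gt0.
have nw (v : A) : star v * v = 1 -> cnorm v = 1.
  move=> hv; apply/eqP; rewrite -(eqrXn2 (n := 2)) ?cnorm_ge0 //.
  by rewrite -cnorm_starM hv cnorm1 expr1n.
(* Multiplying by a power of the unitary w, and undoing it, does not increase the norm. *)
have -> : p.[x] = p.[x] * w ^+ (2 ^ s) * star w ^+ (2 ^ s).
  by rewrite -mulrA -exprMn_comm ?w1' ?expr1n ?mulr1 // /GRing.comm w1 w1'.
rewrite -ha //; apply: le_trans (ler_cnormM _ _) _; rewrite -[leRHS]mulr1.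
apply: ler_pM; rewrite ?cnorm_ge0 //; last first.
  by apply: le_trans (ler_cnormX _ _) _; rewrite cnorm_star nw // expr1n.
apply: circle_bound; first by rewrite nw.
move=> z z1; have -> : \sum_(k < 2 ^ (s + 2)) z ^+ k *: a k =
    \sum_(k < 2 ^ (s + 2)) a k * (z%:A) ^+ k.
  by apply: eq_bigr => k _; rewrite exprZn expr1n mulr_algr.
rewrite (ha _ (scal (complex.Re z) : A)).
- apply: le_trans (ler_cnormM _ _) _; rewrite -[leRHS]mulr1.
  apply: ler_pM; rewrite ?cnorm_ge0 //; last first.
    by apply: le_trans (ler_cnormX _ _) _; rewrite cnorm_alg z1 expr1n.
  apply: hM; rewrite -z1; case: (z) => u v /=.
  by rewrite -sqrtr_sqr ler_wsqrtr // lerDl sqr_ge0.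
- by rewrite mulr_algl mulr_algr.
- rewrite expr2 !mulr_algl !scalerA -[X in _ + X]scale1r -scalerDl.
  congr (_ *: _); move: z1; case: (z) => u v /= z1.
  have {}z1 : u ^+ 2 + v ^+ 2 = 1.
    by rewrite -[LHS]sqr_sqrtr ?z1 ?expr1n // addr_ge0 // sqr_ge0.
  have -> : 2%:R = (2%:R)%:C%C :> R[i] by rewrite rmorph_nat.
  apply/eqP; rewrite eq_complex /=; apply/andP; split; apply/eqP.
    by rewrite -[X in _ + X = _]z1; ring.
  by ring.
Qed.

(** The weak bound is applied to p^(2^k), whose degree is at most 2^(s + k). Since p(x) is normal,
    the norm of its 2^k-th power is the power of its norm, and [le_of_pow2_le] discards the
    factor. *)
Lemma horner_bound (C : set A) (p : {poly A}) (x : A) M :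
  comm_cstar_subalgebra C -> (forall i, C p`_i) ->
  C x -> star x = x -> cnorm x <= 2^-1 -> 0 <= M ->
  (forall t : R, `|t| <= 1 -> cnorm p.[scal t] <= M) -> cnorm p.[x] <= M.
Proof.
move=> hC Cp Cx sx x1 M0 hM.
have [w [Cw w1 hw]] := real_part_of_unitary hC Cx sx x1.
have Cpx (y : A) : C y -> C p.[y].
  move=> Cy; rewrite horner_coef; elim/big_ind: _ => [|a b|i _].
  - exact: (commC0 hC).
  - exact: (commCD hC).
  - by apply: (commCM hC) => //; apply: (commCX hC).
have Csw := commC_star hC Cw.
have w1' : w * star w = 1 by rewrite (commC_comm hC).
have xw2 : w ^+ 2 + 1 = 2%:R *: (x * w).
  by rewrite scalerAl -hw mulrDl w1 expr2.
have cpx (y : A) : C y -> comm_poly p y.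
  by move=> Cy; apply: (commC_comm hC) => //; apply: Cpx.
have [s hs] : exists s, (size p <= (2 ^ s).+1)%N.
  by exists (size p); apply: leq_trans (leqnSn _); apply/ltnW/ltn_expl.
apply: (@le_of_pow2_le _ (2 ^+ (s + 2))) => // [|k]; first exact: cnorm_ge0.
rewrite -cnorm_normal_pow2; last first.
  by apply: (commC_comm hC); [apply: (commC_star hC)|]; apply: Cpx.
rewrite -horner_exp_comm; last exact: cpx.
rewrite -exprD addnAC.
apply: horner_bound_weak w1 w1' xw2 _.
- apply: leq_trans (size_poly_exp_leq _ _) _.
  by rewrite ltnS expnD leq_mul2r; apply/orP; right; case: (size p) hs.
- exact: (commC_comm hC).
move=> t t1; rewrite horner_exp_comm; last first.
  by apply: cpx; apply: (commCZ hC); apply: (commC1 hC).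
apply: le_trans (ler_cnormX _ _) _; apply: lerXn2r; rewrite ?nnegrE ?cnorm_ge0 //.
exact: hM.
Qed.

End PolynomialBound.

(** Syntax lets one polynomial be evaluated in [A], at real points and through characters, all
    compared by induction. Products are ordered, so evaluation makes sense in a noncommutative
    algebra. *)
Inductive pexp (R : realType) n :=
  | PConst of R[i]
  | PVar of 'I_n
  | PAdd of pexp R n & pexp R n
  | PMul of pexp R n & pexp R n.
Arguments PConst {R n}.
Arguments PVar {R n}.

Section PolynomialExpressions.
Local Open Scope classical_set_scope.
Variables (R : realType) (n : nat).
Implicit Types (e : pexp R n).

Fixpoint peval (B : algType R[i]) (k : 'I_n -> B) e : B :=
  match e with
  | PConst c => c%:A
  | PVar i => k i
  | PAdd e1 e2 => peval k e1 + peval k e2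
  | PMul e1 e2 => peval k e1 * peval k e2
  end.

Definition ceval (t : 'I_n -> R) e : R[i] :=
  peval (fun i => (t i)%:C%C : R[i]^o) e.

(** Variables are fixed because they stand for self-adjoint elements or real numbers. *)
Fixpoint pconj e : pexp R n :=
  match e with
  | PConst c => PConst (c^*)%R
  | PVar i => PVar i
  | PAdd e1 e2 => PAdd (pconj e1) (pconj e2)
  | PMul e1 e2 => PMul (pconj e1) (pconj e2)
  end.

Definition psum (es : seq (pexp R n)) := foldr (@PAdd R n) (PConst 0) es.

Definition pexpn e N := iter N (PMul e) (PConst 1).

Lemma peval_psum (B : algType R[i]) (k : 'I_n -> B) es :
  peval k (psum es) = \sum_(e <- es) peval k e.
Proof.
by elim: es => [|e es IH]; rewrite ?big_nil ?big_cons /= ?scale0r ?IH.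
Qed.

Lemma peval_pexpn (B : algType R[i]) (k : 'I_n -> B) e N :
  peval k (pexpn e N) = peval k e ^+ N.
Proof.
by elim: N => [|N IH]; rewrite ?expr0 ?exprS /= ?scale1r ?IH.
Qed.

Lemma peval_rmorph (B B' : algType R[i]) (f : {lrmorphism B -> B'}) k e :
  f (peval k e) = peval (f \o k) e.
Proof.
elim: e => [c|i|e1 h1 e2 h2|e1 h1 e2 h2] //=.
- by rewrite linearZ /= rmorph1.
- by rewrite rmorphD /= h1 h2.
- by rewrite rmorphM /= h1 h2.
Qed.

Lemma peval_scalar (B : algType R[i]) (t : 'I_n -> R) e :
  peval (fun i => (t i)%:C%C%:A : B) e = (ceval t e)%:A.
Proof.
rewrite /ceval; elim: e => [c|i|e1 h1 e2 h2|e1 h1 e2 h2] //=.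
- by rewrite /GRing.scale /= mulr1.
- by rewrite h1 h2 scalerDl.
- by rewrite h1 h2 mulr_algl scalerA.
Qed.

Lemma ceval_conj t e : ceval t (pconj e) = ((ceval t e)^*)%R.
Proof.
rewrite /ceval; elim: e => [c|i|e1 h1 e2 h2|e1 h1 e2 h2] //=.
- by rewrite /GRing.scale /= !mulr1.
- by rewrite conj_real.
- by rewrite h1 h2 rmorphD.
- by rewrite h1 h2 rmorphM.
Qed.

Lemma star_peval (A : cstarAlgType R) (k : 'I_n -> A) e :
  (forall i, star (k i) = k i) -> (forall i j, k i * k j = k j * k i) ->
  star (peval k e) = peval k (pconj e).
Proof.
move=> sk ck; have cke e1 e2 : peval k e1 * peval k e2 = peval k e2 * peval k e1.
  have cv e' i : k i * peval k e' = peval k e' * k i.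
    elim: e' => [c|j|f1 h1 f2 h2|f1 h1 f2 h2] //=.
    - by rewrite mulr_algl mulr_algr.
    - by rewrite mulrDl mulrDr h1 h2.
    - by rewrite mulrA h1 -!mulrA h2.
  elim: e1 => [c|j|f1 h1 f2 h2|f1 h1 f2 h2] //=.
  - by rewrite mulr_algl mulr_algr.
  - by rewrite mulrDl mulrDr h1 h2.
  - by rewrite -mulrA h2 mulrA h1 mulrA.
elim: e => [c|i|e1 h1 e2 h2|e1 h1 e2 h2] //=.
- by rewrite star_alg.
- by rewrite starD h1 h2.
- by rewrite starM h1 h2 cke.
Qed.

Lemma ceval_continuous (T : topologicalType) (c : 'I_n -> T -> R) e :
  (forall i, continuous (c i)) ->
  continuous (fun x => complex.Re (ceval (c^~ x) e)) /\
  continuous (fun x => complex.Im (ceval (c^~ x) e)).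
Proof.
move=> hc; rewrite /ceval; elim: e => [k|i|e1 [h1 h1'] e2 [h2 h2']|e1 [h1 h1'] e2 [h2 h2']] /=.
- by split=> x; apply: cvg_cst.
- by split=> x; [apply: hc|apply: cvg_cst].
- have -> : (fun x => complex.Re (peval (fun i => (c i x)%:C%C : R[i]^o) e1 +
      peval (fun i => (c i x)%:C%C : R[i]^o) e2)) = 
    (fun x => complex.Re (peval (fun i => (c i x)%:C%C : R[i]^o) e1)) \+
    (fun x => complex.Re (peval (fun i => (c i x)%:C%C : R[i]^o) e2)).
    by apply/funext => x /=; case: (peval _ e1) (peval _ e2) => [a b] [a' b'].
  have -> : (fun x => complex.Im (peval (fun i => (c i x)%:C%C : R[i]^o) e1 +
      peval (fun i => (c i x)%:C%C : R[i]^o) e2)) = 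
    (fun x => complex.Im (peval (fun i => (c i x)%:C%C : R[i]^o) e1)) \+
    (fun x => complex.Im (peval (fun i => (c i x)%:C%C : R[i]^o) e2)).
    by apply/funext => x /=; case: (peval _ e1) (peval _ e2) => [a b] [a' b'].
  by split=> x; apply: cvgD; [apply: h1|apply: h2|apply: h1'|apply: h2'].
- set f1 := fun x => complex.Re _; set f2 := fun x => complex.Im _.
  pose r1 x := complex.Re (peval (fun i => (c i x)%:C%C : R[i]^o) e1).
  pose r2 x := complex.Re (peval (fun i => (c i x)%:C%C : R[i]^o) e2).
  pose i1 x := complex.Im (peval (fun i => (c i x)%:C%C : R[i]^o) e1).
  pose i2 x := complex.Im (peval (fun i => (c i x)%:C%C : R[i]^o) e2).
  have -> : f1 = fun x => r1 x * r2 x - i1 x * i2 x.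
    apply/funext => x; rewrite /f1 /r1 /r2 /i1 /i2.
    by case: (peval _ e1) (peval _ e2) => [a b] [a' b'].
  have -> : f2 = fun x => r1 x * i2 x + i1 x * r2 x.
    apply/funext => x; rewrite /f2 /r1 /r2 /i1 /i2.
    by case: (peval _ e1) (peval _ e2) => [a b] [a' b'].
  split=> x.
    by apply: cvgB; apply: cvgM; [apply: h1|apply: h2|apply: h1'|apply: h2'].
  by apply: cvgD; apply: cvgM; [apply: h1|apply: h2'|apply: h1'|apply: h2].
Qed.

Lemma normc_ceval_continuous (T : topologicalType) (c : 'I_n -> T -> R) e :
  (forall i, continuous (c i)) ->
  continuous (fun x => Normc.normc (ceval (c^~ x) e)).
Proof.
move=> hc; have [h1 h2] := ceval_continuous e hc.
have -> : (fun x => Normc.normc (ceval (c^~ x) e)) =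
  Num.sqrt \o (fun x => complex.Re (ceval (c^~ x) e) * complex.Re (ceval (c^~ x) e) +
                        complex.Im (ceval (c^~ x) e) * complex.Im (ceval (c^~ x) e)).
  by apply/funext => x /=; case: (ceval _ e) => a b; rewrite /= -!expr2.
move=> x; apply: continuous_comp; last exact: sqrt_continuous.
by apply: cvgD; apply: cvgM; [apply: h1|apply: h1|apply: h2|apply: h2].
Qed.

End PolynomialExpressions.

(** * Norm of a polynomial in several commuting self-adjoint elements *)

Section MultivariateBound.
Local Open Scope classical_set_scope.
Variables (R : realType) (n : nat) (A : cstarAlgType R).
Implicit Types (e : pexp R n).
Local Notation normc := (@Normc.normc R).
Local Notation scal t := ((t%:C)%C%:A).

(** The i-th variable is kept formal and the others are evaluated. The coefficients lie in [A],
    which is why the one-variable bound was proved for such polynomials. *)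
Fixpoint peval1 (i : 'I_n) (k : 'I_n -> A) e : {poly A} :=
  match e with
  | PConst c => (c%:A)%:P
  | PVar j => if j == i then 'X else (k j)%:P
  | PAdd e1 e2 => peval1 i k e1 + peval1 i k e2
  | PMul e1 e2 => peval1 i k e1 * peval1 i k e2
  end.

Definition update (i : 'I_n) (k : 'I_n -> A) (s : A) : 'I_n -> A :=
  fun j => if j == i then s else k j.

Lemma update_same i k : update i k (k i) = k.
Proof. by apply/funext => j; rewrite /update; case: eqP => // ->. Qed.

Lemma peval_mem (C : set A) k e : comm_cstar_subalgebra C ->
  (forall i, C (k i)) -> C (peval k e).
Proof.
move=> hC Ck; elim: e => [c|j|e1 h1 e2 h2|e1 h1 e2 h2] //=.
- by apply: (commCZ hC); apply: (commC1 hC).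
- exact: (commCD hC).
- exact: (commCM hC).
Qed.

Lemma coef_peval1_mem (C : set A) i k e : comm_cstar_subalgebra C ->
  (forall j, C (k j)) -> forall l, C (peval1 i k e)`_l.
Proof.
move=> hC Ck; elim: e => [c|j|e1 h1 e2 h2|e1 h1 e2 h2] l /=.
- rewrite coefC; case: eqP => _; last exact: (commC0 hC).
  by apply: (commCZ hC); apply: (commC1 hC).
- case: eqP => _; rewrite ?coefX ?coefC; case: eqP => _ //; try exact: (commC0 hC).
  exact: (commC1 hC).
- by rewrite coefD; apply: (commCD hC).
- rewrite coefM; elim/big_ind: _ => [|a b|j _].
  + exact: (commC0 hC).
  + exact: (commCD hC).
  + exact: (commCM hC).
Qed.

Lemma horner_peval1 (C : set A) i k s e : comm_cstar_subalgebra C ->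
  (forall j, C (k j)) -> C s -> (peval1 i k e).[s] = peval (update i k s) e.
Proof.
move=> hC Ck Cs; have Cu j : C (update i k s j) by rewrite /update; case: eqP.
elim: e => [c|j|e1 h1 e2 h2|e1 h1 e2 h2] /=.
- by rewrite hornerC.
- by rewrite /update; case: eqP => _; rewrite ?hornerX ?hornerC.
- by rewrite hornerD h1 h2.
- rewrite hornerM_comm ?h1 ?h2 // /comm_poly h2.
  by apply: (commC_comm hC) => //; apply: peval_mem.
Qed.

Lemma cube_bound (C : set A) (k : 'I_n -> A) e M :
  comm_cstar_subalgebra C -> (forall i, C (k i)) ->
  (forall i, star (k i) = k i) -> (forall i, cnorm (k i) <= 2^-1) -> 0 <= M ->
  (forall t : 'I_n -> R, (forall i, `|t i| <= 1) -> normc (ceval t e) <= M) ->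
  cnorm (peval k e) <= M.
Proof.
move=> hC Ck sk k1 M0 hM.
pose scalar a := exists2 t : R, `|t| <= 1 & a = scal t :> A.
(* Variables are turned into real scalars one at a time: [m] counts those that may still be genuine
   elements of [A], and [horner_bound] trades the last of them for all its scalar values in
   [-1, 1]. *)
suff H m : forall k : 'I_n -> A, (forall i, C (k i)) -> (forall i, star (k i) = k i) ->
    (forall i, cnorm (k i) <= 2^-1 \/ scalar (k i)) ->
    (forall i : 'I_n, (m <= i)%N -> scalar (k i)) -> cnorm (peval k e) <= M.
  apply: (H n) => // i; first by left.
  by rewrite leqNgt ltn_ord.
elim: m => [|m IH] {Ck sk k1} {}k Ck sk k1 kt.
  have /choice[t ht] i : exists t : R, `|t| <= 1 /\ k i = scal t.
    by have [t] := kt i isT; exists t.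
  have -> : k = fun i => scal (t i) by apply/funext => i; case: (ht i).
  by rewrite peval_scalar cnorm_alg; apply: hM => i; case: (ht i).
have [mn|nm] := ltnP m n; last first.
  by apply: IH => // i mi; have := leq_trans nm mi; rewrite leqNgt ltn_ord.
pose i := Ordinal mn.
have other (j : 'I_n) : (m <= j)%N -> j != i -> (m < j)%N.
  move=> mj ji; rewrite ltn_neqAle mj andbT.
  by apply: contra ji => /eqP mj'; rewrite -val_eqE /= mj'.
have [ki|ki] := k1 i; last first.
  apply: IH => // j mj; have [->//|ji] := eqVneq j i; exact/kt/other.
rewrite -(update_same i k) -(horner_peval1 i e hC) //.
apply: (horner_bound hC) => // [l|t t1]; first exact: coef_peval1_mem.
have Ct : C (scal t) by apply: (commCZ hC); apply: (commC1 hC).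
rewrite (horner_peval1 i e hC) //; apply: IH => j; rewrite /update.
- by case: eqP.
- by case: eqP => // _; rewrite star_alg conj_real.
- by case: eqP => // _; right; exists t.
- by move=> mj; case: eqP => [_|/eqP ji]; [exists t|apply/kt/other].
Qed.

Definition cube : set 'rV[R]_n := [set v | forall i, `|v ord0 i| <= 1].

Lemma cube_compact : compact cube.
Proof.
have := @rV_compact R n (fun=> `[-1, 1]) (fun=> @segment_compact _ _ _).
congr compact; apply/seteqP; split=> v h i; have := h i; rewrite /= in_itv /=.
  by rewrite -ler_norml.
by rewrite -ler_norml.
Qed.

Local Notation evalrow v := (ceval (fun i => v ord0 i)).

(* Multiplying e by (1 - r / c)^N, where r is the sum of the squared moduli of
   the relations, does not change its value at k but makes it small off the
   zero set. *)
Lemma zeros_bound (I : finType) (C : set A) (k : 'I_n -> A) (r : I -> pexp R n) e M :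
  comm_cstar_subalgebra C -> (forall i, C (k i)) ->
  (forall i, star (k i) = k i) -> (forall i, cnorm (k i) <= 2^-1) -> 0 <= M ->
  (forall i, peval k (r i) = 0) ->
  (forall v, cube v -> (forall i, evalrow v (r i) = 0) ->
     normc (evalrow v e) <= M) ->
  cnorm (peval k e) <= M.
Proof.
move=> hC Ck sk k1 M0 kr hM.
pose rho := psum [seq PMul (pconj (r i)) (r i) | i <- enum I].
pose nr (v : 'rV[R]_n) := normc (evalrow v rho).
pose ne (v : 'rV[R]_n) := normc (evalrow v e).
have cont f : continuous (fun v : 'rV[R]_n => normc (evalrow v f)).
  by apply: (@normc_ceval_continuous _ _ _ (fun i (v : 'rV[R]_n) => v ord0 i)) =>
     i; apply: coord_continuous.
have rhoE (v : 'rV[R]_n) : evalrow v rho = ((\sum_i normc (evalrow v (r i)) ^+ 2)%:C)%C.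
  rewrite /ceval peval_psum big_map big_enum rmorph_sum /=; apply: eq_bigr => i _.
  rewrite -/(ceval _ _) -/(ceval _ _) ceval_conj.
  case: (ceval _ (r i)) => a b; rewrite /= sqr_sqrtr ?addr_ge0 ?sqr_ge0 //.
  by apply/eqP; rewrite eq_complex /=; apply/andP; split; apply/eqP; ring.
have nrE (v : 'rV[R]_n) : nr v = \sum_i normc (evalrow v (r i)) ^+ 2.
  by rewrite /nr rhoE normc_real ger0_norm // sumr_ge0 // => i _; rewrite sqr_ge0.
have krho : peval k rho = 0.
  by rewrite peval_psum big_map big1 // => i _ /=; rewrite kr mulr0.
have zero v : nr v = 0 -> forall i, evalrow v (r i) = 0.
  rewrite nrE => /psumr_eq0P h i; apply: Normc.eq0_normc; apply/eqP.
  by rewrite -sqrf_eq0 h // => j _; rewrite sqr_ge0.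
have cube0 : cube !=set0 by exists 0 => i; rewrite mxE normr0.
have bounded f : exists2 E, 0 < E & forall v, cube v -> normc (evalrow v f) <= E.
  have [|v _ hv] := EVT_max_rV cube0 cube_compact (f := fun v => normc (evalrow v f)).
    exact: continuous_subspaceT.
  exists (normc (evalrow v f) + 1) => [|w cw].
    by rewrite ltr_wpDl ?normc_ge0.
  by apply: le_trans (hv w _) _; rewrite ?inE // lerDl.
have [c c0 hc] := bounded rho; have [E E0 hE] := bounded e.
apply: le_of_lt_add => eps eps0; have e20 : 0 < eps / 2 by rewrite divr_gt0.
pose F := [set v | cube v /\ M + eps / 2 <= ne v].
(* [F] is the compact set where e is too large. The relations have no common zero on it, so [nr] has
   a positive minimum there; if F is empty, any d will do. *)
have [d d0 hd] : exists2 d, 0 < d & forall v, F v -> d <= nr v.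
  have [[v0 Fv0]|F0] := pselect (exists v, F v); last first.
    by exists 1 => // v Fv; case: F0; exists v.
  have Fc : compact F.
    have -> : F = cube `&` ne @^-1` [set x | M + eps / 2 <= x] by [].
    apply: compact_closedI; first exact: cube_compact.
    apply: preimage_closed; [by move=> x _; apply: cont|exact: closed_ge].
  have [||v] := EVT_min_rV (f := nr) (A := F) _ Fc.
  - by exists v0.
  - by apply: continuous_subspaceT; apply: cont.
  rewrite inE => -[cv Fv] hv; exists (nr v) => [|w Fw]; last by apply: hv; rewrite inE.
  rewrite lt_def normc_ge0 andbT; apply/eqP => /zero/hM - /(_ cv).
  by move/(le_trans Fv); rewrite gerDl leNgt e20.
(* On [F] the multiplier 1 - nr / c is at most q. The minimum with 1 keeps q nonnegative also when d
   was chosen arbitrarily. *)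
pose q := 1 - Num.min (d / c) 1; have q1 : 0 <= q < 1.
  by rewrite subr_ge0 ge_min lexx orbT /= gtrBl lt_min ltr01 divr_gt0.
have [N hN] := exprn_small q1 (divr_gt0 e20 E0).
pose g := PAdd (PConst 1) (PMul (PConst (- (c^-1)%:C%C)) rho).
have kg : peval k (PMul e (pexpn g N)) = peval k e.
  by rewrite /= peval_pexpn /= krho mulr0 addr0 scale1r expr1n mulr1.
have gE (v : 'rV[R]_n) : evalrow v g = ((1 - nr v / c)%:C)%C.
  have := rhoE v; rewrite -nrE /ceval /= => ->.
  rewrite /GRing.scale /= !mulr1 mulNr -!rmorphM /= -rmorphN /=.
  by rewrite -(rmorph1 (real_complex R)) -rmorphD /= [_^-1 * _]mulrC.
rewrite -kg; apply: (@le_lt_trans _ _ (M + eps / 2)); last first.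
  by rewrite ltrD2l ltr_pdivrMr // ltr_pMr // ltr1n.
apply: (cube_bound hC) => // [|t t1]; first by rewrite addr_ge0 // ltW.
have [v tv] : exists v : 'rV[R]_n, t = fun i => v ord0 i.
  by exists (\row_i t i); apply/funext => i; rewrite mxE.
have {t1}cv : cube v by move=> i; have := t1 i; rewrite tv.
rewrite {t}tv {1}/ceval /= peval_pexpn -/(ceval _ e) -/(ceval _ g) gE.
rewrite Normc.normcM normc_exp normc_real.
have y0 : 0 <= nr v / c by rewrite divr_ge0 ?normc_ge0 // ltW.
have y1 : nr v / c <= 1 by rewrite ler_pdivrMr // mul1r hc.
rewrite ger0_norm ?subr_ge0 //.
(* Off [F] the polynomial is already small and the multiplier is at most 1; on [F] the N-th power of
   the multiplier beats the global bound [E]. *)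
have [Fv|Fv] := leP (M + eps / 2) (ne v); last first.
  apply: le_trans (ltW Fv); rewrite -[leRHS]mulr1 ler_wpM2l ?normc_ge0 //.
  by rewrite exprn_ile1 ?subr_ge0 // gerBl.
apply: (@le_trans _ _ (E * q ^+ N)).
  apply: ler_pM; rewrite ?normc_ge0 ?exprn_ge0 ?subr_ge0 ?hE //.
  apply: lerXn2r; rewrite ?nnegrE ?subr_ge0 //; first by case/andP: q1; rewrite subr_ge0.
  by rewrite lerD2l lerN2 ge_min ler_pM2r ?invr_gt0 // hd.
have /ltW := hN N (leqnn N); rewrite ler_pdivlMr // mulrC => /le_trans; apply.
by rewrite lerDr.
Qed.

End MultivariateBound.

(** * Uniform approximation of continuous functions by polynomials *)

Section PolynomialDensity.
Local Open Scope classical_set_scope.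
Variables (R : realType) (X : topologicalType) (n : nat) (c : 'I_n -> X -> R).

Definition polyfun (g : X -> R) :=
  exists e, forall x, ceval (c^~ x) e = ((g x)%:C)%C.

Lemma polyfun_cst (a : R) : polyfun (fun=> a).
Proof. by exists (PConst (a%:C)%C) => x; rewrite /ceval /= /GRing.scale /= mulr1. Qed.

Lemma polyfun_coord i : polyfun (c i).
Proof. by exists (PVar i). Qed.

Lemma polyfunD g h : polyfun g -> polyfun h -> polyfun (fun x => g x + h x).
Proof.
move=> [e he] [e' he']; exists (PAdd e e') => x.
by rewrite rmorphD /= -he -he'.
Qed.

Lemma polyfunM g h : polyfun g -> polyfun h -> polyfun (fun x => g x * h x).
Proof.
move=> [e he] [e' he']; exists (PMul e e') => x.
by rewrite rmorphM /= -he -he'.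
Qed.

Lemma polyfunB g h : polyfun g -> polyfun h -> polyfun (fun x => g x - h x).
Proof.
move=> hg hh; have -> : (fun x => g x - h x) = fun x => g x + -1 * h x.
  by apply/funext => x; rewrite mulN1r.
by apply: polyfunD => //; apply: polyfunM => //; apply: polyfun_cst.
Qed.

Lemma polyfunX g N : polyfun g -> polyfun (fun x => g x ^+ N).
Proof.
move=> hg; elim: N => [|N IH]; first exact: (polyfun_cst 1).
by under eq_fun do rewrite exprS; apply: polyfunM.
Qed.

Lemma polyfun_sum (I : Type) (s : seq I) (F : I -> X -> R) :
  (forall i, polyfun (F i)) -> polyfun (fun x => \sum_(i <- s) F i x).
Proof.
move=> hF; elim: s => [|i s IH].
  by under eq_fun do rewrite big_nil; apply: polyfun_cst.
by under eq_fun do rewrite big_cons; apply: polyfunD.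
Qed.

(** Left squared so that it is a polynomial in the coordinates of [x] for each fixed [y]. *)
Definition sqdist x y : R := \sum_i (c i x - c i y) ^+ 2.

Lemma sqdist_ge0 x y : 0 <= sqdist x y.
Proof. by apply: sumr_ge0 => i _; rewrite sqr_ge0. Qed.

Hypotheses (Xc : compact [set: X]) (cc : forall i, continuous (c i)).
Hypothesis csep : forall x y, (forall i, c i x = c i y) -> x = y.

Lemma continuous_sum (T : topologicalType) (I : Type) (s : seq I)
    (F : I -> T -> R) :
  (forall i, continuous (F i)) -> continuous (fun x => \sum_(i <- s) F i x).
Proof.
move=> hF; elim: s => [|i s IH] x.
  by under eq_fun do rewrite big_nil; apply: cvg_cst.
under eq_fun do rewrite big_cons.
by apply: cvgD; [apply: hF|apply: IH].
Qed.

Lemma sqdist_continuous : continuous (fun p : X * X => sqdist p.1 p.2).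
Proof.
apply: continuous_sum => i p; under eq_fun do rewrite expr2.
have h : c i q.1 - c i q.2 @[q --> p] --> c i p.1 - c i p.2.
  apply: cvgB.
    by apply: (@continuous_comp _ _ _ fst (c i)); [exact: cvg_fst|exact: cc].
  by apply: (@continuous_comp _ _ _ snd (c i)); [exact: cvg_snd|exact: cc].
exact: (cvgM h h).
Qed.

Lemma compact_bounded_above (T : topologicalType) (K : set T) (g : T -> R) :
  compact K -> continuous g -> exists2 M, 0 < M & forall x, K x -> g x <= M.
Proof.
move=> Kc gc; have [[x0 Kx0]|K0] := pselect (K !=set0); last first.
  by exists 1 => // x Kx; case: K0; exists x.
have [|x _ hx] := compact_EVT_max _ Kc (continuous_subspaceT gc).
  by exists x0.
exists (Num.max (g x) 1) => [|y Ky]; first by rewrite lt_max ltr01 orbT.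
by rewrite le_max hx ?inE.
Qed.

(** The pairs whose values differ by at least [eps] form a compact set, on which [sqdist] attains
    its minimum; this is positive because the coordinates separate points. *)
Lemma unif_cont (f : X -> R) eps : continuous f -> 0 < eps ->
  exists2 d, 0 < d & forall x y, sqdist x y < d -> `|f x - f y| < eps.
Proof.
move=> fc e0; pose g (p : X * X) := `|f p.1 - f p.2|.
have gc : continuous g.
  move=> p; apply: cvg_norm; apply: cvgB.
    by apply: (@continuous_comp _ _ _ fst f); [exact: cvg_fst|exact: fc].
  by apply: (@continuous_comp _ _ _ snd f); [exact: cvg_snd|exact: fc].
pose K := g @^-1` [set r | eps <= r].
have Kc : compact K.
  have -> : K = ([set: X] `*` [set: X]) `&` K by rewrite setXTT setTI.
  apply: compact_closedI; first exact: compact_setX.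
  by apply: preimage_closed; [move=> x _; apply: gc|exact: closed_ge].
have [[p0 Kp0]|K0] := pselect (K !=set0); last first.
  by exists 1 => // x y _; rewrite ltNge; apply/negP => h; case: K0; exists (x, y).
have [|p] := compact_EVT_min _ Kc (continuous_subspaceT sqdist_continuous).
  by exists p0.
rewrite inE => Kp hp; exists (sqdist p.1 p.2) => [|x y xy].
  rewrite lt_def sqdist_ge0 andbT; apply/eqP => d0.
  have e12 : p.1 = p.2.
    apply: csep => i; apply/eqP; rewrite -subr_eq0 -sqrf_eq0; apply/eqP.
    by have /psumr_eq0P := d0; apply => // j _; rewrite sqr_ge0.
  by move: Kp; rewrite /K /= /g e12 subrr normr0 leNgt e0.
rewrite ltNge; apply/negP => h.
by have := hp (x, y); rewrite inE => /(_ h); rewrite leNgt xy.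
Qed.

(** Near-covering compactness is applied to the filter of finite lists directed by inclusion: each
    point is covered locally once the list contains it, hence one list serves all points. *)
Lemma finite_net d : 0 < d -> exists s : seq X, forall x, exists2 y, y \in s & sqdist x y < d.
Proof.
move=> d0.
pose F : set_system (seq X) := [set Q | exists s0 : seq X, forall s : seq X, {subset s0 <= s} -> Q s].
have FF : Filter F.
  split; first by exists [::].
    move=> P Q [s1 h1] [s2 h2]; exists (s1 ++ s2) => s hs.
    by split; [apply: h1|apply: h2] => x hx; apply: hs; rewrite mem_cat hx ?orbT.
  by move=> P Q PQ [s1 h1]; exists s1 => s /h1/PQ.
have /compact_near_coveringP/(_ (seq X) F
  (fun s x => exists2 y, y \in s & sqdist x y < d) FF) := Xc.
case=> [x _|s /(_ s (fun _ => id)) h]; last by exists s => x; apply: h.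
exists ([set x' | sqdist x' x < d], [set s : seq X | x \in s]); last first.
  by move=> [x' s] [/= h hs]; exists x.
split; last by exists [:: x] => s; apply; rewrite mem_head.
apply: open_nbhs_nbhs; split; last first.
  by rewrite /= /sqdist big1 // => i _; rewrite subrr expr0n.
apply: open_comp (@open_lt R d) => x' _.
apply: continuous_sum => i {}x'; under eq_fun do rewrite expr2.
by apply: cvgM; apply: cvgB; [apply: cc|apply: cvg_cst|apply: cc|apply: cvg_cst].
Qed.

(** The quotient g / s is a weighted mean of values of f at net points, with weights b_y^N that peak
    near y. It approximates f within 2 [eps]. Replacing 1 / s by a truncated geometric series makes
    it polynomial and costs one more [eps]. *)
Lemma real_polynomial_density (f : X -> R) eps : continuous f -> 0 < eps ->
  exists2 g, polyfun g & forall x, `|f x - g x| <= 3 * eps.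
Proof.
move=> fc e0; have [d d0 hd] := unif_cont fc e0.
have [ys hys] := finite_net (divr_gt0 d0 (ltr0Sn R 1)).
have [Dm' Dm0' hDm'] := compact_bounded_above (compact_setX Xc Xc) sqdist_continuous.
(* The added [d] makes d / Dm < 1, so that [be] below is positive. *)
pose Dm := Dm' + d; have Dm0 : 0 < Dm by rewrite addr_gt0.
have [F F0 hF] : exists2 F, 0 < F & forall x, `|f x| <= F.
  have [|F F0 hF] := compact_bounded_above (g := fun x => `|f x|) Xc.
    by move=> x; apply: cvg_norm; apply: fc.
  by exists F => // x; apply: hF.
pose b y x := 1 - sqdist x y / Dm.
have b0 y x : 0 <= b y x.
  rewrite subr_ge0 ler_pdivrMr // mul1r; apply: le_trans (hDm' (x, y) _) _ => //.
  by rewrite lerDl ltW.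
have b1 y x : b y x <= 1 by rewrite gerBl divr_ge0 ?sqdist_ge0 // ltW.
(* These are the values of b at squared distances d / 2 and d. Some net point has weight at least
   al^N, while far points have weight at most be^N. *)
pose al := 1 - d / 2 / Dm; pose be := 1 - d / Dm.
have dD : d / Dm < 1 by rewrite ltr_pdivrMr // mul1r ltrDr.
have dD0 : 0 < d / Dm by rewrite divr_gt0.
have al_be : be < al by rewrite ltrD2l ltrN2 ltr_pM2r ?invr_gt0 // ltr_pdivrMr // ltr_pMr // ltr1n.
have be0 : 0 < be by rewrite subr_gt0.
have al0 : 0 < al by apply: lt_trans al_be.
pose m : R := (size ys)%:R + 1; have m0 : 0 < m by rewrite ltr_wpDl.
have ba : 0 <= be / al < 1.
  by rewrite divr_ge0 ?ltW //= ltr_pdivrMr // mul1r.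
(* With this N the far points contribute at most 2 F be^N each, in total at most [eps] times al^N,
   hence at most [eps] times s. *)
have [|N hN] := exprn_small (e := eps / (2 * F * m)) ba.
  by rewrite divr_gt0 // !mulr_gt0.
pose s x := \sum_(y <- ys) b y x ^+ N.
pose g x := \sum_(y <- ys) f y * b y x ^+ N.
have al1 : al <= 1 by rewrite gerBl !divr_ge0 // ltW.
have s_ge x : al ^+ N <= s x.
  have [y yy xy] := hys x; rewrite /s (big_rem y) //=.
  apply: (@le_trans _ _ (b y x ^+ N)).
    apply: lerXn2r; rewrite ?nnegrE ?(ltW al0) // lerD2l lerN2.
    by rewrite ler_pM2r ?invr_gt0 // ltW.
  by rewrite lerDl sumr_ge0 // => z _; rewrite exprn_ge0.
have s_gt x : 0 < s x by apply: lt_le_trans (s_ge x); rewrite exprn_gt0.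
have s_lt x : s x <= m.
  apply: (@le_trans _ _ (\sum_(y <- ys) (1 : R))).
    by apply: ler_sum => y _; rewrite exprn_ile1.
  by rewrite big_const_seq count_predT iter_addr_0 lerDl.
have gs x : `|f x * s x - g x| <= 2 * eps * s x.
  rewrite /g /s mulr_sumr -sumrB.
  apply: (@le_trans _ _ (\sum_(y <- ys) (eps * b y x ^+ N + 2 * F * be ^+ N))).
    apply: le_trans (ler_norm_sum _ _ _) _; apply: ler_sum => y _.
    rewrite -mulrBl normrM [X in _ * X]ger0_norm ?exprn_ge0 //.
    have [xy|xy] := ltP (sqdist x y) d.
      apply: (@le_trans _ _ (eps * b y x ^+ N)).
        by rewrite ler_wpM2r ?exprn_ge0 // ltW // hd.
      by rewrite lerDl !mulr_ge0 ?exprn_ge0 // ltW.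
    apply: (@le_trans _ _ (2 * F * be ^+ N)); last first.
      by rewrite lerDr mulr_ge0 ?exprn_ge0 // ltW.
    apply: ler_pM; rewrite ?exprn_ge0 //.
      apply: le_trans (ler_normB _ _) _.
      by rewrite mulr_natl mulr2n lerD.
    apply: lerXn2r; rewrite ?nnegrE ?(ltW be0) // lerD2l lerN2.
    by rewrite ler_pM2r ?invr_gt0.
  rewrite big_split /= -mulr_sumr -/(s x) big_const_seq count_predT iter_addr_0.
  have -> : 2 * eps * s x = eps * s x + eps * s x by ring.
  rewrite lerD2l -[_ *+ size _]mulr_natr.
  apply: (@le_trans _ _ (eps * al ^+ N)); last by rewrite ler_wpM2l // ltW.
  have /ltW := hN N (leqnn N).
  rewrite expr_div_n ler_pdivlMr; last by rewrite !mulr_gt0.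
  rewrite mulrAC ler_pdivrMr ?exprn_gt0 //; apply: le_trans.
  rewrite [leLHS](_ : _ = be ^+ N * (2 * F * (size ys)%:R)); last by ring.
  rewrite ler_wpM2l ?exprn_ge0 ?(ltW be0) // ler_wpM2l ?lerDl //.
  by rewrite mulr_ge0 // ltW.
(* Since al^N <= s <= m, this bounds the ratio 1 - s / m of the geometric series for 1 / s uniformly
   below 1. *)
pose q0 := 1 - al ^+ N / m.
have q0b : 0 <= q0 < 1.
  rewrite gtrBl divr_gt0 ?exprn_gt0 // andbT subr_ge0 ler_pdivrMr // mul1r.
  by apply: (@le_trans _ _ 1); rewrite ?exprn_ile1 ?(ltW al0) // lerDr.
have [L hL] := exprn_small q0b (divr_gt0 e0 F0).
pose inv x := m^-1 * \sum_(l <- iota 0 L) (1 - s x / m) ^+ l.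
have ps : polyfun s.
  apply: polyfun_sum => y; apply: polyfunX; apply: polyfunB; first exact: polyfun_cst.
  apply: polyfunM; last exact: polyfun_cst.
  apply: polyfun_sum => i; apply: polyfunX; apply: polyfunB; last exact: polyfun_cst.
  exact: polyfun_coord.
exists (fun x => g x * inv x).
  apply: polyfunM.
    apply: polyfun_sum => y; apply: polyfunM; first exact: polyfun_cst.
    apply: polyfunX; apply: polyfunB; first exact: polyfun_cst.
    apply: polyfunM; last exact: polyfun_cst.
    apply: polyfun_sum => i; apply: polyfunX; apply: polyfunB; last exact: polyfun_cst.
    exact: polyfun_coord.
  apply: polyfunM; first exact: polyfun_cst.
  apply: polyfun_sum => l; apply: polyfunX; apply: polyfunB; first exact: polyfun_cst.
  by apply: polyfunM => //; exact: polyfun_cst.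
move=> x; have sx := s_gt x; pose z := 1 - s x / m.
have invE : inv x = (1 - z ^+ L) / s x.
  have -> : inv x = m^-1 * \sum_(l < L) z ^+ l.
    by rewrite /inv -(subn0 L) -/(index_iota 0 L) big_mkord subn0.
  have := subrX1 z L; rewrite -(opprB 1 z) -(opprB 1 (z ^+ L)) mulNr => /oppr_inj ->.
  by rewrite /z opprB addrCA subrr addr0; field; rewrite !gt_eqF.
have z0 : 0 <= z by rewrite subr_ge0 ler_pdivrMr // mul1r.
have zL : z ^+ L <= eps / F.
  apply: le_trans (ltW (hL L (leqnn L))); apply: lerXn2r; rewrite ?nnegrE //.
    by case/andP: q0b.
  by rewrite lerD2l lerN2 ler_pM2r ?invr_gt0.
have gF : `|g x| <= F * s x.
  rewrite /g /s mulr_sumr; apply: le_trans (ler_norm_sum _ _ _) _.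
  apply: ler_sum => y _; rewrite normrM [X in _ * X]ger0_norm ?exprn_ge0 //.
  by rewrite ler_wpM2r ?exprn_ge0.
have -> : f x - g x * inv x = (f x * s x - g x) / s x + g x * z ^+ L / s x.
  by rewrite invE; field; rewrite gt_eqF.
have -> : 3 * eps = 2 * eps + eps by ring.
apply: le_trans (ler_normD _ _) _; apply: lerD.
  rewrite normrM [X in _ * X]ger0_norm ?invr_ge0 ?(ltW sx) //.
  by rewrite ler_pdivrMr.
rewrite !normrM [X in _ * X]ger0_norm ?invr_ge0 ?(ltW sx) // ler_pdivrMr //.
rewrite [X in _ * X]ger0_norm ?exprn_ge0 //.
apply: le_trans (ler_pM _ _ gF zL) _; rewrite ?exprn_ge0 //.
by rewrite [F * _]mulrC -mulrA [F * _]mulrC divfK ?gt_eqF // mulrC.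
Qed.

Lemma polynomial_density (f : X -> R[i]) eps :
  continuous (fun x => complex.Re (f x)) -> continuous (fun x => complex.Im (f x)) -> 0 < eps ->
  exists e, forall x, Normc.normc (f x - ceval (c^~ x) e) < eps.
Proof.
move=> fr fi e0; have e8 : 0 < eps / 8 by rewrite divr_gt0.
have [g [e he] hg] := real_polynomial_density fr e8.
have [h [e' he'] hh] := real_polynomial_density fi e8.
exists (PAdd e (PMul (PConst 'i%C) e')) => x.
have -> : f x - ceval (c^~ x) (PAdd e (PMul (PConst 'i%C) e')) =
    ((complex.Re (f x) - g x)%:C)%C + 'i%C * ((complex.Im (f x) - h x)%:C)%C.
  rewrite {1}/ceval /= -!/(ceval _ _) he he' /GRing.scale /=.
  case: (f x) => a b; apply/eqP; rewrite eq_complex /=.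
  by apply/andP; split; apply/eqP; ring.
apply: le_lt_trans (normc_add _ _) _; rewrite Normc.normcM !normc_real.
have -> : Normc.normc ('i%C : R[i]) = 1 by rewrite /= expr0n /= expr1n add0r sqrtr1.
rewrite mul1r; apply: le_lt_trans (lerD (hg x) (hh x)) _.
by lra.
Qed.

End PolynomialDensity.

Notation o2 i := (@Ordinal 2 i isT).
Notation o3 i := (@Ordinal 3 i isT).
Notation o4 i := (@Ordinal 4 i isT).


Section SmallMatrices.
Variable V : nmodType.

Lemma sum_ord2 (F : 'I_2 -> V) : \sum_i F i = F (o2 0) + F (o2 1).
Proof.
by rewrite !big_ord_recl big_ord0 addr0; congr (F _ + F _); apply: val_inj.
Qed.

Lemma sum_ord3 (F : 'I_3 -> V) : \sum_i F i = F (o3 0) + F (o3 1) + F (o3 2).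
Proof.
rewrite !big_ord_recl big_ord0 addr0 addrA.
by congr (F _ + F _ + F _); apply: val_inj.
Qed.

Lemma sum_ord4 (F : 'I_4 -> V) :
  \sum_i F i = F (o4 0) + F (o4 1) + F (o4 2) + F (o4 3).
Proof.
rewrite !big_ord_recl big_ord0 addr0 !addrA.
by congr (F _ + F _ + F _ + F _); apply: val_inj.
Qed.

Lemma ord2_ind (P : 'I_2 -> Prop) : P (o2 0) -> P (o2 1) -> forall i, P i.
Proof.
by move=> p0 p1 [[|[|//]] h]; [move: p0|move: p1]; congr P; apply: val_inj.
Qed.

Lemma ord3_ind (P : 'I_3 -> Prop) :
  P (o3 0) -> P (o3 1) -> P (o3 2) -> forall i, P i.
Proof.
move=> p0 p1 p2 [[|[|[|//]]] h]; [move: p0|move: p1|move: p2];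
  by congr P; apply: val_inj.
Qed.

Lemma ord4_ind (P : 'I_4 -> Prop) :
  P (o4 0) -> P (o4 1) -> P (o4 2) -> P (o4 3) -> forall i, P i.
Proof.
move=> p0 p1 p2 p3 [[|[|[|[|//]]]] h]; [move: p0|move: p1|move: p2|move: p3];
  by congr P; apply: val_inj.
Qed.

End SmallMatrices.

Section Determinants.
Variable K : comNzRingType.

Lemma det_ord2 (M : 'M[K]_2) :
  \det M = M (o2 0) (o2 0) * M (o2 1) (o2 1) - M (o2 0) (o2 1) * M (o2 1) (o2 0).
Proof.
rewrite (expand_det_row _ (o2 0)) sum_ord2 /cofactor !det_mx11 !mxE /=.
rewrite expr0 expr1 mul1r mulN1r mulrN.
by congr (_ * M _ _ - _ * M _ _); apply: val_inj.
Qed.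

Lemma det_ord3 (M : 'M[K]_3) (m := fun i j => M i j) :
  let a := (o3 0) in let b := (o3 1) in let c := (o3 2) in
  \det M = m a a * (m b b * m c c - m b c * m c b)
         - m a b * (m b a * m c c - m b c * m c a)
         + m a c * (m b a * m c b - m b b * m c a).
Proof.
move=> a b c; rewrite (expand_det_row _ a) sum_ord3 /cofactor !det_ord2 !mxE /=.
rewrite expr0 expr1 sqrrN expr1n !mul1r mulN1r mulrN /m.
by congr (_ * (M _ _ * M _ _ - M _ _ * M _ _) - _ * (M _ _ * M _ _ - M _ _ * M _ _)
  + _ * (M _ _ * M _ _ - M _ _ * M _ _)); apply: val_inj.
Qed.

End Determinants.

(** * Rotations and products of quaternion coordinates *)

Section Rotations.
Local Open Scope classical_set_scope.
Variable R : realType.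

Definition mx_of n (l : seq (seq R)) : 'M[R]_n :=
  \matrix_(i, j) nth 0 (nth [::] l i) j.

(* The rotation by the quaternion q, as a function of the K_ij = q_i q_j. *)
Definition rot (K : 'M[R]_4) : 'M[R]_3 :=
  let k i j := K (inord i) (inord j) in
  mx_of 3 [::
    [:: k 0 0 + k 1 1 - k 2 2 - k 3 3; 2 * (k 1 2 - k 0 3); 2 * (k 1 3 + k 0 2)];
    [:: 2 * (k 1 2 + k 0 3); k 0 0 - k 1 1 + k 2 2 - k 3 3; 2 * (k 2 3 - k 0 1)];
    [:: 2 * (k 1 3 - k 0 2); 2 * (k 2 3 + k 0 1); k 0 0 - k 1 1 - k 2 2 + k 3 3]].

(** The entries are 4 q_i q_j for a rotation by q. They are affine in [M], so no sign of q has to be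
    chosen. *)
Definition quat4 (M : 'M[R]_3) : 'M[R]_4 :=
  let m i j := M (inord i) (inord j) in
  mx_of 4 [::
    [:: 1 + m 0 0 + m 1 1 + m 2 2; m 2 1 - m 1 2; m 0 2 - m 2 0; m 1 0 - m 0 1];
    [:: m 2 1 - m 1 2; 1 + m 0 0 - m 1 1 - m 2 2; m 0 1 + m 1 0; m 0 2 + m 2 0];
    [:: m 0 2 - m 2 0; m 0 1 + m 1 0; 1 - m 0 0 + m 1 1 - m 2 2; m 1 2 + m 2 1];
    [:: m 1 0 - m 0 1; m 0 2 + m 2 0; m 1 2 + m 2 1; 1 - m 0 0 - m 1 1 + m 2 2]].

Definition quat (M : 'M[R]_3) : 'M[R]_4 := 4^-1 *: quat4 M.

(** Equations for the matrices q q^T with q a unit vector; [quat_ex] recovers q. *)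
Definition is_quat (K : 'M[R]_4) :=
  [/\ forall i j, K i j = K j i, \sum_i K i i = 1
    & forall i j l, K i i * K j l = K i j * K i l].

Lemma inord_ord3 : (inord 0 = (o3 0) :> 'I_3) * (inord 1 = (o3 1) :> 'I_3) *
  (inord 2 = (o3 2) :> 'I_3).
Proof. by do !split; apply: val_inj; rewrite /= inordK. Qed.

Lemma inord_ord4 : (inord 0 = (o4 0) :> 'I_4) * (inord 1 = (o4 1) :> 'I_4) *
  (inord 2 = (o4 2) :> 'I_4) * (inord 3 = (o4 3) :> 'I_4).
Proof. by do !split; apply: val_inj; rewrite /= inordK. Qed.

(** The hypotheses are orthonormality of rows, orthonormality of columns, and equality of each entry
    with its cofactor. Given all of these, every quadratic relation to be proved is linear in the
    monomials, within reach of [lra]. *)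
Lemma is_quat_mx (a b c d e f g h i : R) :
  a * a + b * b + c * c = 1 -> a * d + b * e + c * f = 0 ->
  a * g + b * h + c * i = 0 -> d * d + e * e + f * f = 1 ->
  d * g + e * h + f * i = 0 -> g * g + h * h + i * i = 1 ->
  a * a + d * d + g * g = 1 -> a * b + d * e + g * h = 0 ->
  a * c + d * f + g * i = 0 -> b * b + e * e + h * h = 1 ->
  b * c + e * f + h * i = 0 -> c * c + f * f + i * i = 1 ->
  e * i - f * h = a -> c * h - b * i = d -> b * f - c * e = g ->
  f * g - d * i = b -> a * i - c * g = e -> c * d - a * f = h ->
  d * h - e * g = c -> b * g - a * h = f -> a * e - b * d = i ->
  is_quat (4^-1 *: mx_of 4 [::
    [:: 1 + a + e + i; h - f; c - g; d - b];
    [:: h - f; 1 + a - e - i; b + d; c + g];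
    [:: c - g; b + d; 1 - a + e - i; f + h];
    [:: d - b; c + g; f + h; 1 - a - e + i]]).
Proof.
move=> e1 e2 e3 e4 e5 e6 e7 e8 e9 e10 e11 e12 e13 e14 e15 e16 e17 e18 e19 e20 e21.
split.
- by apply: ord4_ind; apply: ord4_ind; rewrite !mxE.
- by rewrite sum_ord4 !mxE /=; field.
move=> x y z; rewrite !mxE [LHS]mulrACA [RHS]mulrACA; congr (_ * _).
by move: x y z; apply: ord4_ind; apply: ord4_ind; apply: ord4_ind => /=; lra.
Qed.

Lemma quat_SO3 M : SO3 R M -> is_quat (quat M).
Proof.
move=> [MM dM]; have MtM : M^T *m M = 1%:M by apply: mulmx1C.
have row_eq i j : (M *m M^T) i j = (1%:M : 'M[R]_3) i j by rewrite MM.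
have col_eq i j : (M^T *m M) i j = (1%:M : 'M[R]_3) i j by rewrite MtM.
pose m i j := M (inord i) (inord j).
(* The adjugate of [M]; with determinant 1 it is the inverse, that is, the transpose, which yields
   the cofactor equations. *)
pose N := mx_of 3 [::
  [:: m 1 1 * m 2 2 - m 1 2 * m 2 1; m 0 2 * m 2 1 - m 0 1 * m 2 2;
      m 0 1 * m 1 2 - m 0 2 * m 1 1];
  [:: m 1 2 * m 2 0 - m 1 0 * m 2 2; m 0 0 * m 2 2 - m 0 2 * m 2 0;
      m 0 2 * m 1 0 - m 0 0 * m 1 2];
  [:: m 1 0 * m 2 1 - m 1 1 * m 2 0; m 0 1 * m 2 0 - m 0 0 * m 2 1;
      m 0 0 * m 1 1 - m 0 1 * m 1 0]].
have MN : M *m N = 1%:M.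
  move: dM; rewrite det_ord3 => dM.
  apply/matrixP; apply: ord3_ind; apply: ord3_ind;
    rewrite mxE sum_ord3 !mxE /= /m !inord_ord3 /=;
    rewrite ?mulr1n ?mulr0n; first [by ring | by rewrite -[RHS]dM; ring].
have cof : N = M^T by rewrite -[N]mul1mx -MtM -mulmxA MN mulmx1.
have cof_eq i j : N i j = M^T i j by rewrite cof.
move: (row_eq (o3 0) (o3 0)) (row_eq (o3 0) (o3 1)) (row_eq (o3 0) (o3 2))
  (row_eq (o3 1) (o3 1)) (row_eq (o3 1) (o3 2)) (row_eq (o3 2) (o3 2))
  (col_eq (o3 0) (o3 0)) (col_eq (o3 0) (o3 1)) (col_eq (o3 0) (o3 2))
  (col_eq (o3 1) (o3 1)) (col_eq (o3 1) (o3 2)) (col_eq (o3 2) (o3 2))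
  (cof_eq (o3 0) (o3 0)) (cof_eq (o3 0) (o3 1)) (cof_eq (o3 0) (o3 2))
  (cof_eq (o3 1) (o3 0)) (cof_eq (o3 1) (o3 1)) (cof_eq (o3 1) (o3 2))
  (cof_eq (o3 2) (o3 0)) (cof_eq (o3 2) (o3 1)) (cof_eq (o3 2) (o3 2)).
rewrite !mxE !sum_ord3 !mxE /= /m /quat /quat4 !inord_ord3; exact: is_quat_mx.
Qed.

(** As the trace is 1, some K_ii is positive; the i-th row divided by the square root of K_ii is
    q. *)
Lemma quat_ex K : is_quat K ->
  exists2 q : 'I_4 -> R, \sum_i q i ^+ 2 = 1 & forall i j, K i j = q i * q j.
Proof.
move=> [Ks K1 KK].
have [i Ki] : exists i, 0 < K i i.
  apply: contrapT => /forallNP h; have : (0 : R) < 1 by []. rewrite -K1 ltNge => /negP; apply.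
  by apply: sumr_le0 => i _; rewrite leNgt; apply/negP/h.
pose r := Num.sqrt (K i i); have r0 : r != 0 by rewrite gt_eqF // sqrtr_gt0.
have rr : r * r = K i i by rewrite -expr2 sqr_sqrtr // ltW.
have qq j l : K j l = (K i j / r) * (K i l / r).
  by rewrite mulrACA -KK -invfM rr mulrAC mulfV ?mul1r // gt_eqF.
exists (fun j => K i j / r) => //.
by rewrite -K1; apply: eq_bigr => j _; rewrite expr2 -qq.
Qed.

Lemma rot_SO3 (a b c d : R) : a ^+ 2 + b ^+ 2 + c ^+ 2 + d ^+ 2 = 1 ->
  SO3 R (mx_of 3 [::
    [:: a * a + b * b - c * c - d * d; 2 * (b * c - a * d); 2 * (b * d + a * c)];
    [:: 2 * (b * c + a * d); a * a - b * b + c * c - d * d; 2 * (c * d - a * b)];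
    [:: 2 * (b * d - a * c); 2 * (c * d + a * b); a * a - b * b - c * c + d * d]]).
Proof.
move=> q1; rewrite /SO3 /=.
(* For arbitrary q the matrix times its transpose is |q|^4 times the identity and the determinant is
   |q|^6; these powers make the goals ring identities. *)
have q2 : (a ^+ 2 + b ^+ 2 + c ^+ 2 + d ^+ 2) ^+ 2 = 1 by rewrite q1 expr1n.
have q3 : (a ^+ 2 + b ^+ 2 + c ^+ 2 + d ^+ 2) ^+ 3 = 1 by rewrite q1 expr1n.
split; last by rewrite det_ord3 !mxE /= -[RHS]q3; ring.
apply/matrixP; apply: ord3_ind; apply: ord3_ind; rewrite !mxE sum_ord3 !mxE /=;
  rewrite ?mulr1n ?mulr0n; first [by ring | by rewrite -[RHS]q2; ring].
Qed.

Lemma rot_quat (q : 'I_4 -> R) (K : 'M[R]_4) : \sum_i q i ^+ 2 = 1 ->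
  (forall i j, K i j = q i * q j) ->
  SO3 R (rot K) /\ quat (rot K) = K.
Proof.
rewrite sum_ord4 => q1 Kq.
have rK := rot_SO3 q1; split; first by move: rK; rewrite /rot /= !inord_ord4 !Kq.
apply/matrixP => i j; rewrite Kq; move: i j.
rewrite /quat /quat4 /rot !inord_ord3 !mxE /= !inord_ord4 !Kq.
move: q1; set a := q (o4 0); set b := q (o4 1); set c := q (o4 2); set d := q (o4 3).
move=> q1; apply: ord4_ind; apply: ord4_ind; rewrite !mxE /= -/a -/b -/c -/d;
  move: (a) (b) (c) (d) q1 => {a b c d}a b c d q1; lra.
Qed.

End Rotations.

(** * The complex numbers as a C*-algebra, and characters *)

Section ComplexCStar.
Local Open Scope classical_set_scope.
Variable R : realType.
Local Notation normc := (@Normc.normc R).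

Lemma ReD (a b : R[i]) : complex.Re (a + b) = complex.Re a + complex.Re b.
Proof. by case: a; case: b. Qed.

Lemma ImD (a b : R[i]) : complex.Im (a + b) = complex.Im a + complex.Im b.
Proof. by case: a; case: b. Qed.

Lemma Re_le_normc (a : R[i]) : `|complex.Re a| <= normc a.
Proof. by case: a => a b /=; rewrite -sqrtr_sqr ler_wsqrtr // lerDl sqr_ge0. Qed.

Lemma Im_le_normc (a : R[i]) : `|complex.Im a| <= normc a.
Proof. by case: a => a b /=; rewrite -sqrtr_sqr ler_wsqrtr // lerDr sqr_ge0. Qed.

Lemma normc_le_ReIm (a : R[i]) :
  normc a <= `|complex.Re a| + `|complex.Im a|.
Proof.
have {1}-> : a = (complex.Re a)%:C%C + 'i%C * (complex.Im a)%:C%C.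
  by case: a => a b; apply/eqP; rewrite eq_complex /=; apply/andP; split; apply/eqP; ring.
apply: le_trans (normc_add _ _) _; rewrite Normc.normcM !normc_real.
by rewrite /= expr0n /= expr1n add0r sqrtr1 mul1r.
Qed.

Lemma real_cauchy_cvg (u : nat -> R) :
  (forall e, 0 < e -> exists N : nat, forall m n, (N <= m)%N -> (N <= n)%N ->
     `|u m - u n| < e) -> cvg (u @ \oo).
Proof.
move=> h; apply: cauchy_cvg; apply: cauchy_exP => e e0.
have [N hN] := h e e0; exists (u N); exists N => // n Nn.
by rewrite /ball /= hN.
Qed.

Lemma normc_complete (v : nat -> R[i]^o) :
  (forall e : R, 0 < e -> exists N : nat, forall m n : nat,
      (N <= m)%N -> (N <= n)%N -> normc (v m - v n) < e) ->
  exists l : R[i]^o, normc (v n - l) @[n --> \oo] --> (0 : R).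
Proof.
move=> h.
have /real_cauchy_cvg hr : forall e, 0 < e -> exists N : nat, forall m n,
    (N <= m)%N -> (N <= n)%N -> `|complex.Re (v m) - complex.Re (v n)| < e.
  move=> e /h[N hN]; exists N => m n Nm Nn; apply: le_lt_trans (hN m n Nm Nn).
  apply: le_trans (Re_le_normc _); rewrite ReD.
  by case: (v n) => a b.
have /real_cauchy_cvg hi : forall e, 0 < e -> exists N : nat, forall m n,
    (N <= m)%N -> (N <= n)%N -> `|complex.Im (v m) - complex.Im (v n)| < e.
  move=> e /h[N hN]; exists N => m n Nm Nn; apply: le_lt_trans (hN m n Nm Nn).
  apply: le_trans (Im_le_normc _); rewrite ImD.
  by case: (v n) => a b.
pose r := lim ((fun n => complex.Re (v n)) @ \oo).
pose s := lim ((fun n => complex.Im (v n)) @ \oo).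
exists (Complex r s).
apply: (@squeeze_cvgr _ _ _ _ (fun=> 0)
  (fun n => `|complex.Re (v n) - r| + `|complex.Im (v n) - s|)).
- near=> n; rewrite normc_ge0 /=; apply: le_trans (normc_le_ReIm _) _.
  by rewrite ReD ImD.
- exact: cvg_cst.
- rewrite -[X in _ --> X](addr0 (0 : R)); apply: cvgD.
    by rewrite -(normr0 R) -(subrr r); apply: cvg_norm; apply: cvgB => //; exact: cvg_cst.
  by rewrite -(normr0 R) -(subrr s); apply: cvg_norm; apply: cvgB => //; exact: cvg_cst.
Unshelve. all: by end_near.
Qed.

Lemma normc_conjM (a : R[i]^o) : normc ((a^*)%R * a) = normc a ^+ 2.
Proof.
rewrite Normc.normcM expr2; congr (_ * _).
by case: a => a b /=; rewrite sqrrN.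
Qed.

Lemma normc_leM (a b : R[i]^o) : normc (a * b) <= normc a * normc b.
Proof. by rewrite Normc.normcM. Qed.

(** Makes the scalars a target for the universal property, which then produces characters. *)
HB.instance Definition _ := isCStar.Build R (R[i]^o)
  (@conjCK R[i]) (fun a b => rmorphD Num.conj a b)
  (fun k a => rmorphM Num.conj k a)
  (fun a b => etrans (rmorphM Num.conj a b) (mulrC _ _))
  (@Normc.eq0_normc R) (@Normc.normcM R) (@le_normcD R)
  normc_leM normc_conjM normc_complete.

(** If |f a| exceeded the norm of a, then 1 - a / f(a) would have a right inverse by [neumann],
    although f sends it to 0. *)
Lemma star_morphism_contractive (A : cstarAlgType R)
    (f : {lrmorphism A -> R[i]^o}) a : normc (f a) <= cnorm a.
Proof.
rewrite leNgt; apply/negP => fa; pose l := f a.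
have l0 : l != 0.
  by apply/eqP => l0; move: fa; rewrite -/l l0 Normc.normc0 ltNge cnorm_ge0.
have [|b] := @neumann R A (l^-1 *: a).
  rewrite cnormZ Normc.normcV mulrC ltr_pdivrMr ?mul1r //.
  by apply: le_lt_trans fa; apply: cnorm_ge0.
have fZ : f (l^-1 *: a) = 1 by rewrite linearZ /= /GRing.scale /= -/l mulVf.
have f1 : f 1 = 1 := rmorph1 f.
move/(congr1 f); rewrite rmorphM rmorphB /= fZ f1 subrr mul0r.
by move/esym/eqP; rewrite (oner_eq0 R[i]).
Qed.

End ComplexCStar.

(** * SO(3) as a compact space with separating coordinates *)

Section TopologySO3.
Local Open Scope classical_set_scope.
Variable R : realType.

Lemma continuous_mul (T : topologicalType) (a b : T -> R) :
  continuous a -> continuous b -> continuous (fun x => a x * b x).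
Proof. by move=> ha hb x; apply: cvgM; [apply: ha|apply: hb]. Qed.

Lemma continuous_add (T : topologicalType) (a b : T -> R) :
  continuous a -> continuous b -> continuous (fun x => a x + b x).
Proof. by move=> ha hb x; apply: cvgD; [apply: ha|apply: hb]. Qed.

Lemma continuous_opp (T : topologicalType) (a : T -> R) :
  continuous a -> continuous (fun x => - a x).
Proof. by move=> ha x; apply: cvgN; apply: ha. Qed.

Lemma continuous_const (T : topologicalType) (k : R) : continuous (fun _ : T => k).
Proof. by move=> x; apply: cvg_cst. Qed.

Lemma continuous_mx (T : topologicalType) m n (f : T -> 'M[R]_(m, n)) :
  (forall i j, continuous (fun x => f x i j)) -> continuous f.
Proof.
move=> hf x B [P hP PB].
have : \forall y \near x, forall i j, P i j (f y i j).
  by apply: filter_forall => i; apply: filter_forall => j; apply: hf; apply: hP.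
by apply: filterS => y hy; apply: PB.
Qed.

Lemma compact_set_type (T : topologicalType) (K : set T) :
  compact K -> compact [set: K].
Proof.
move=> Kc F FF _; pose G := (set_val : K -> T) @ F.
have GK : G K.
  by apply: (@filterS _ F _ setT (set_val @^-1` K) (fun x _ => set_valP x)); apply: filterT.
have [p [Kp clp]] := Kc G (fmap_proper_filter _ FF) GK.
exists (@exist _ _ p (mem_set Kp)); split=> // A B FA [_ /= [] [W oW <- /= Wp sWB]].
have GA : G (set_val @` A).
  by apply: (@filterS _ F _ A (set_val @^-1` (set_val @` A))) FA => a Aa; exists a.
have [y [[a Aa <-] Wa]] := clp _ W GA (open_nbhs_nbhs (conj oW Wp)).
by exists a; split=> //; apply: sWB.
Qed.

Definition row_quat (q : 'rV[R]_4) : 'M[R]_4 := \matrix_(i, j) (q ord0 i * q ord0 j).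

Definition sphere : set 'rV[R]_4 := [set q | \sum_i q ord0 i ^+ 2 = 1].

Lemma sphere_compact : compact sphere.
Proof.
have -> : sphere = @cube R 4 `&` sphere.
  apply/seteqP; split=> [q hq|q [] //]; split=> // i.
  rewrite -(@ler_pXn2r _ 2) ?nnegrE // expr1n real_normK ?num_real // -hq.
  by rewrite (bigD1 i) //= lerDl sumr_ge0 // => j _; rewrite sqr_ge0.
apply: compact_closedI; first exact: cube_compact.
have -> : sphere = (fun q : 'rV[R]_4 => \sum_i q ord0 i ^+ 2) @^-1` [set 1] by [].
apply: preimage_closed; last exact: closed_eq.
move=> q _; apply: continuous_sum => i; under eq_fun do rewrite expr2.
by apply: continuous_mul; apply: coord_continuous.
Qed.

(** An affine identity, valid for all matrices; it shows that the coordinates [quat_coord] separate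
    points. *)
Lemma quatK (M : 'M[R]_3) : rot (quat M) = M.
Proof.
apply/matrixP => i j; rewrite /rot /quat /quat4 !inord_ord4 !inord_ord3 !mxE /=.
move: i j; apply: ord3_ind; apply: ord3_ind => /=;
  move: (M (o3 0) (o3 0)) (M (o3 0) (o3 1)) (M (o3 0) (o3 2))
    (M (o3 1) (o3 0)) (M (o3 1) (o3 1)) (M (o3 1) (o3 2))
    (M (o3 2) (o3 0)) (M (o3 2) (o3 1)) (M (o3 2) (o3 2)) => a b c d e f g h i; lra.
Qed.

(** SO(3) is the continuous image of the unit sphere of quaternions. *)
Lemma SO3_compact : compact (SO3 R).
Proof.
have -> : SO3 R = (fun q => rot (row_quat q)) @` sphere.
  apply/seteqP; split=> [M hM|_ [q hq <-]].
    have [q q1 Kq] := quat_ex (quat_SO3 hM).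
    exists (\row_i q i); first by rewrite /sphere /= -q1; apply: eq_bigr => i _; rewrite mxE.
    rewrite /= -[RHS]quatK; congr (rot _); apply/matrixP => i j.
    by rewrite Kq !mxE.
  by have [] := @rot_quat R (fun i => q ord0 i) (row_quat q) hq (fun i j => mxE _ _ _ _).
apply: continuous_compact; last exact: sphere_compact.
apply: continuous_subspaceT; apply: continuous_mx.
have hc i : continuous (fun q : 'rV[R]_4 => q ord0 i) by apply: coord_continuous.
have qc i j : continuous (fun q => row_quat q i j).
  by under eq_fun do rewrite mxE; apply: continuous_mul.
apply: ord3_ind; apply: ord3_ind; under eq_fun do rewrite /= mxE /=;
  by do ?[exact: qc | apply: continuous_mul | apply: continuous_add |
           apply: continuous_opp | apply: continuous_const].
Qed.

Lemma setT_SO3_compact : compact [set: SO3 R].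
Proof. exact: compact_set_type SO3_compact. Qed.

(** The functions on SO(3) that will correspond to the elements [kvars s], with the same scale and
    the same flattening of index pairs. *)
Definition quat_coord (s : R) (l : 'I_(4 * 4)) (x : SO3 R) : R :=
  s * mxvec (quat (set_val x)) 0 l.

Lemma quat_coord_continuous s l : continuous (quat_coord s l).
Proof.
case/mxvec_indexP: l => i j.
have vc : continuous (set_val : SO3 R -> 'M[R]_3) by apply: initial_continuous.
have hc a b : continuous (fun x : SO3 R => set_val x a b).
  move=> x; apply: (@continuous_comp _ _ _ (set_val : SO3 R -> 'M[R]_3) (fun M : 'M[R]_3 => M a b) x).
    exact: vc.
  exact: (@coord_continuous R 3 3 a b).
suff h : continuous (fun x : SO3 R => quat (set_val x) i j).
  rewrite /quat_coord; under eq_fun do rewrite mxvecE.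
  by apply: continuous_mul => //; apply: continuous_const.
under eq_fun do rewrite mxE; apply: continuous_mul; first exact: continuous_const.
move: i j; apply: ord4_ind; apply: ord4_ind; under eq_fun do rewrite mxE;
  by do ?[exact: hc | apply: continuous_add | apply: continuous_opp | apply: continuous_const].
Qed.

Lemma quat_coord_inj s x y : s != 0 ->
  (forall l, quat_coord s l x = quat_coord s l y) -> x = y.
Proof.
move=> s0 h; apply: val_inj; rewrite /= -[LHS]quatK -[RHS]quatK; congr (rot _).
apply: (can_inj mxvecK); apply/rowP => l; apply: (mulfI s0); exact: h.
Qed.

End TopologySO3.

(** * Quaternion coordinates of the fundamental representation *)

Section QuaternionRelations.
Variables (R : realType) (A : cstarAlgType R) (n : nat) (q : 'I_n -> A).

Hypotheses (q1 : forall i j, q i * star (q j) = q j * star (q i))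
           (q2 : forall i j, star (q i) * q j = star (q j) * q i).

Local Notation k i j := (star (q i) * q j).

Lemma quat_rel_sym i j : k i j = k j i.
Proof. exact: q2. Qed.

Lemma quat_rel_star i j : star (k i j) = k i j.
Proof. by rewrite starM starK q2. Qed.

Lemma quat_rel_mid i j l m : k i j * k l m = k i l * k j m.
Proof. by rewrite -!mulrA [q j * _]mulrA q1 !mulrA. Qed.

(** Symmetry exchanges the indices inside a factor and [quat_rel_mid] the two middle ones; these
    transpositions generate all permutations of the four indices. *)
Lemma quat_rel_comm i j l m : k i j * k l m = k l m * k i j.
Proof.
rewrite quat_rel_mid (quat_rel_sym i) quat_rel_mid (quat_rel_sym i) quat_rel_mid.
by rewrite (quat_rel_sym j).
Qed.

End QuaternionRelations.

Section PauliForm.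
Variables (V W : zmodType) (F : V -> V -> W) (a b c d : V).
Hypotheses (FDl : forall x y z, F (x + y) z = F x z + F y z)
           (FDr : forall x y z, F z (x + y) = F z x + F z y)
           (FNl : forall x z, F (- x) z = - F x z)
           (FNr : forall x z, F z (- x) = - F z x).
Hypotheses (dd : F d d = F a a) (cc : F c c = F b b)
  (bd : F b d = - F a c) (cd : F c d = - F a b)
  (db : F d b = - F c a) (dc : F d c = - F b a).

(** [F] covers both x [star] y and [star] x y. It is only biadditive, since one argument is
    conjugated. The sign in each equation is (-1)^(m + n) for the positions m, n in the list a + d,
    b + c, b - c, a - d. *)
Lemma pauli_form :
  [/\ F (a + d) (b + c) = - F (b + c) (a + d),
      F (a + d) (b - c) = F (b - c) (a + d) &
      F (a + d) (a - d) = - F (a - d) (a + d)] /\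
  [/\ F (b + c) (b - c) = - F (b - c) (b + c),
      F (b + c) (a - d) = F (a - d) (b + c) &
      F (b - c) (a - d) = - F (a - d) (b - c)].
Proof.
have swap (x y z w : W) : x + y + z + w = w + y + z + x.
  by rewrite [LHS]addrC -[x + y + z]addrA [x + _]addrC !addrA.
rewrite !(FDl, FDr, FNl, FNr, dd, cc, bd, cd, db, dc) ?opprD ?opprK ?addrA.
by split; split; apply: swap.
Qed.

End PauliForm.

Section QuaternionCoordinates.
Variables (R : realType) (A : cstarAlgType R) (u : 'M[A]_2).
Hypotheses (uU : unitary_mx u) (uU' : unitary_mx (conj_mx u)).

Let a := u (o2 0) (o2 0).
Let b := u (o2 0) (o2 1).
Let c := u (o2 1) (o2 0).
Let d := u (o2 1) (o2 1).

(* u = q_0 + i (q_1 sigma_1 + q_2 sigma_2 + q_3 sigma_3); the factor of q_m is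
   real for even m and imaginary for odd m. *)
Definition pauli (m : 'I_4) : A := nth 0 [:: a + d; b + c; b - c; a - d] m.

Definition qscale (m : 'I_4) : R[i] := if odd m then - ('i%C / 2) else 2^-1.

Definition qcoord (m : 'I_4) : A := qscale m *: pauli m.

Lemma unitary_entries (v : 'M[A]_2) : unitary_mx v ->
  (forall i j, v i (o2 0) * star (v j (o2 0)) + v i (o2 1) * star (v j (o2 1)) = (i == j)%:R) /\
  (forall i j, star (v (o2 0) i) * v (o2 0) j + star (v (o2 1) i) * v (o2 1) j = (i == j)%:R).
Proof.
move=> [h1 h2]; split=> i j.
  by have /matrixP/(_ i j) := h1; rewrite !mxE sum_ord2 !mxE.
by have /matrixP/(_ i j) := h2; rewrite !mxE sum_ord2 !mxE.
Qed.

Lemma qscale_conj m : ((qscale m)^*)%R = (-1) ^+ m * qscale m.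
Proof.
have c2 : ((2^-1 : R[i])^*)%R = 2^-1 by rewrite fmorphV rmorph_nat.
rewrite /qscale -signr_odd; case: (odd m); last by rewrite c2 expr0 mul1r.
by rewrite rmorphN rmorphM /= conj_i c2 expr1 mulN1r mulNr.
Qed.

(** The signs are exactly those that conjugation produces on [qscale], so they cancel for the
    q_m. *)
Lemma pauli_sym (F : A -> A -> A) :
  (forall x y z, F (x + y) z = F x z + F y z) ->
  (forall x y z, F z (x + y) = F z x + F z y) ->
  (forall x z, F (- x) z = - F x z) -> (forall x z, F z (- x) = - F z x) ->
  (forall i j, F (u i (o2 0)) (u j (o2 0)) + F (u i (o2 1)) (u j (o2 1)) = (i == j)%:R) ->
  (forall i j, F (u (o2 0) i) (u (o2 0) j) + F (u (o2 1) i) (u (o2 1) j) = (i == j)%:R) ->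
  forall m n : 'I_4, (-1) ^+ n *: F (pauli m) (pauli n) =
              ((-1) ^+ m : R[i]) *: F (pauli n) (pauli m).
Proof.
move=> FDl FDr FNl FNr hr hc.
have neg (x y : A) : x + y = 0 -> y = - x by move=> h; apply/eqP; rewrite -addr_eq0 addrC h.
have e0 := hr (o2 0) (o2 0); have e1 := hc (o2 0) (o2 0).
have e2 := hc (o2 1) (o2 1); have e3 := hr (o2 0) (o2 1).
have e4 := hr (o2 1) (o2 0); have e5 := hc (o2 0) (o2 1).
have e6 := hc (o2 1) (o2 0).
have bd := neg _ _ e3; have db := neg _ _ e4; have cd := neg _ _ e5; have dc := neg _ _ e6.
have cc : F c c = F b b by apply: (addrI (F a a)); rewrite e0 e1.
have dd : F d d = F a a.
  by apply: (addrI (F b b)); rewrite e2 addrC e0.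
have [[h01 h02 h03] [h12 h13 h23]] := pauli_form FDl FDr FNl FNr dd cc bd cd db dc.
by apply: ord4_ind; apply: ord4_ind => //;
  rewrite /pauli /= ?(h01, h02, h03, h12, h13, h23) ?expr0 ?expr1 ?sqrrN ?expr1n
    ?(exprS _ 2) ?sqrrN ?expr1n ?mulr1 ?scaleN1r ?scale1r ?opprK.
Qed.

Lemma scale_swapr (x y e f : R[i]) (v w : A) : e *: v = f *: w ->
  (x * (e * y)) *: v = (y * (f * x)) *: w.
Proof.
move=> h; rewrite (_ : x * (e * y) = (x * y) * e); last by ring.
by rewrite -scalerA h scalerA; congr (_ *: _); ring.
Qed.

Lemma scale_swapl (x y e f : R[i]) (v w : A) : e *: v = f *: w ->
  (e * x * y) *: v = (f * y * x) *: w.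
Proof.
move=> h; rewrite (_ : e * x * y = (x * y) * e); last by ring.
by rewrite -scalerA h scalerA; congr (_ *: _); ring.
Qed.

(** Unitarity of [u] supplies the row relations and unitarity of its conjugate the column relations;
    in [qcoord_right] they exchange roles. *)
Lemma qcoord_left m n :
  qcoord m * star (qcoord n) = qcoord n * star (qcoord m).
Proof.
have [hr _] := unitary_entries uU; have [_ hc] := unitary_entries uU'.
have h : (-1) ^+ n *: (pauli m * star (pauli n)) =
         ((-1) ^+ m : R[i]) *: (pauli n * star (pauli m)).
  apply: (@pauli_sym (fun x y => x * star y)) => // [x y z|x y z|x z|x z|i j].
  - by rewrite mulrDl.
  - by rewrite starD mulrDr.
  - by rewrite mulNr.
  - by rewrite starN mulrN.
  - by rewrite -hc !mxE !starK.
rewrite /qcoord !starZ -!scalerAl -!scalerAr !scalerA !qscale_conj.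
exact: scale_swapr.
Qed.

Lemma qcoord_right m n :
  star (qcoord m) * qcoord n = star (qcoord n) * qcoord m.
Proof.
have [_ hc] := unitary_entries uU; have [hr _] := unitary_entries uU'.
have h : (-1) ^+ n *: (star (pauli m) * pauli n) =
         ((-1) ^+ m : R[i]) *: (star (pauli n) * pauli m).
  apply: (@pauli_sym (fun x y => star x * y)) => // [x y z|x y z|x z|x z|i j].
  - by rewrite starD mulrDl.
  - by rewrite mulrDr.
  - by rewrite starN mulNr.
  - by rewrite mulrN.
  - by rewrite -hr !mxE !starK.
have {}h : (-1) ^+ m *: (star (pauli m) * pauli n) =
         ((-1) ^+ n : R[i]) *: (star (pauli n) * pauli m).
  have sq k : (-1) ^+ k * (-1) ^+ k = 1 :> R[i] by rewrite -expr2 sqrr_sign.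
  have := congr1 (fun x => ((-1) ^+ m * (-1) ^+ n : R[i]) *: x) h.
  by rewrite !scalerA -mulrA sq mulr1 mulrAC sq mul1r.
rewrite /qcoord !starZ -!scalerAl -!scalerAr !scalerA !qscale_conj.
exact: scale_swapl.
Qed.

Lemma qcoord_sum : \sum_m star (qcoord m) * qcoord m = 1.
Proof.
have [_ hc] := unitary_entries uU.
have qq m : star (qcoord m) * qcoord m = 4^-1 *: (star (pauli m) * pauli m).
  rewrite /qcoord starZ -scalerAl -scalerAr scalerA; congr (_ *: _).
  rewrite qscale_conj /qscale -signr_odd; case: (odd m).
    rewrite expr1 (_ : _ * _ = - ('i%C * 'i%C) / 4); last by field.
    by rewrite -expr2 sqr_i opprK mul1r.
  by rewrite expr0 mul1r; field.
under eq_bigr do rewrite qq.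
rewrite -scaler_sumr sum_ord4 /pauli /=.
(* The parallelogram law reduces the sum to half of that of [star x * x] over the four entries of
   [u], and each column contributes 1. *)
have par (x y : A) : star (x + y) * (x + y) + star (x - y) * (x - y) =
    (star x * x + star y * y) *+ 2.
  have -> : star (x + y) * (x + y) =
      star x * x + star x * y + (star y * y + star y * x).
    by rewrite starD mulrDl !mulrDr [star y * y + _]addrC.
  have -> : star (x - y) * (x - y) =
      star x * x - star x * y + (star y * y - star y * x).
    by rewrite starB mulrBl !mulrBr opprB.
  by rewrite addrACA (addrACA (star x * x)) (addrACA (star y * y)) !subrr !addr0
    mulr2n addrACA.
rewrite -[_ + _ + star (b - c) * _]addrA addrAC !par -mulrnDl.
have := hc (o2 0) (o2 0); have := hc (o2 1) (o2 1).
rewrite -/a -/b -/c -/d => e1 e0.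
rewrite [star b * b + _]addrC addrACA e0 [star d * d + _]addrC e1 -mulrnDl.
have -> : ((1 + 1) *+ 2 : A) = (4%:R : R[i]) *: 1 by rewrite scaler_nat -mulr2n -mulrnA.
by rewrite scalerA mulVf ?scale1r ?pnatr_eq0.
Qed.

(** Together with [qcoord_comb] it shows that the q_m and the entries of [u] span the same space,
    which transfers membership in a subalgebra between the K_mn and the tensor product. *)
Lemma qcoord_entry i j : exists s : 'I_4 -> R[i], u i j = \sum_m s m *: qcoord m.
Proof.
have i2 (x : A) : 'i%C *: (- ('i%C / 2) *: x) = (2^-1 : R[i]) *: x.
  by rewrite scalerA mulrN mulrA -expr2 sqr_i mulN1r opprK.
have halfD (x : A) : (2^-1 : R[i]) *: (x + x) = x.
  rewrite scalerDr -scalerDl (_ : 2^-1 + 2^-1 = 1) ?scale1r //.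
  by rewrite -[X in X + _]mul1r -[X in _ + X]mul1r -splitr.
have half (x y : A) : (2^-1 : R[i]) *: (x + y) + (2^-1 : R[i]) *: (x - y) = x.
  by rewrite -scalerDr addrACA subrr addr0 halfD.
have half' (x y : A) : (2^-1 : R[i]) *: (x + y) - (2^-1 : R[i]) *: (x - y) = y.
  by rewrite -scalerBr opprB [x + y]addrC addrACA subrr addr0 halfD.
move: i j; apply: ord2_ind; apply: ord2_ind.
- exists (fun m : 'I_4 => nth 0 [:: 1; 0; 0; 'i%C] m); rewrite sum_ord4 /qcoord /pauli /qscale /=.
  by rewrite i2 !scale0r !addr0 scale1r half.
- exists (fun m : 'I_4 => nth 0 [:: 0; 'i%C; 1; 0] m); rewrite sum_ord4 /qcoord /pauli /qscale /=.
  by rewrite i2 !scale0r add0r addr0 scale1r half.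
- exists (fun m : 'I_4 => nth 0 [:: 0; 'i%C; -1; 0] m); rewrite sum_ord4 /qcoord /pauli /qscale /=.
  by rewrite i2 !scale0r add0r addr0 scaleN1r half'.
- pose k : R[i] := - 'i%C.
  exists (fun m : 'I_4 => nth 0 [:: 1; 0; 0; k] m); rewrite sum_ord4 /qcoord /pauli /qscale /=.
  by rewrite /k !scale0r !addr0 scale1r (scaleNr 'i%C) i2 half'.
Qed.

Lemma qcoord_comb m : exists s : 'I_2 -> 'I_2 -> R[i],
  qcoord m = \sum_i \sum_j s i j *: u i j.
Proof.
rewrite /qcoord; move: (qscale m) => k; move: m.
have ex (s : seq (seq R[i])) x : x = \sum_(i < 2) \sum_(j < 2) nth 0 (nth [::] s i) j *: u i j ->
    exists s : 'I_2 -> 'I_2 -> R[i], k *: x = \sum_i \sum_j s i j *: u i j.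
  move=> ->; exists (fun i j => k * nth 0 (nth [::] s i) j).
  rewrite scaler_sumr; apply: eq_bigr => i _; rewrite scaler_sumr.
  by apply: eq_bigr => j _; rewrite scalerA.
apply: ord4_ind; rewrite /pauli /=.
- by apply: (ex [:: [:: 1; 0]; [:: 0; 1]]); rewrite !sum_ord2 /= !scale1r !scale0r addr0 add0r.
- by apply: (ex [:: [:: 0; 1]; [:: 1; 0]]); rewrite !sum_ord2 /= !scale1r !scale0r addr0 add0r.
- by apply: (ex [:: [:: 0; 1]; [:: -1; 0]]); rewrite !sum_ord2 /= scaleN1r !scale1r !scale0r addr0 add0r.
- by apply: (ex [:: [:: 1; 0]; [:: 0; -1]]); rewrite !sum_ord2 /= scaleN1r !scale1r !scale0r addr0 add0r.
Qed.

End QuaternionCoordinates.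

(** * The bound by the supremum over SO(3) *)

Section QuaternionBound.
Local Open Scope classical_set_scope.
Variables (R : realType) (A : cstarAlgType R).
Local Notation normc := (@Normc.normc R).

(** The sixteen K_mn, scaled by [s] and flattened into one family so that they can be the variables
    of a [pexp]. *)
Definition kvars (s : R) (q : 'I_4 -> A) (l : 'I_(4 * 4)) : A :=
  (s%:C)%C *: mxvec (\matrix_(i, j) (star (q i) * q j)) 0 l.

Lemma kvarsE s q i j : kvars s q (mxvec_index i j) = (s%:C)%C *: (star (q i) * q j).
Proof. by rewrite /kvars mxvecE mxE. Qed.

Lemma kvars_star s q l : (forall i j, star (q i) * q j = star (q j) * q i) ->
  star (kvars s q l) = kvars s q l.
Proof.
move=> q2; case/mxvec_indexP: l => i j.
by rewrite kvarsE starZ conj_real quat_rel_star.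
Qed.

Lemma kvars_comm s q : (forall i j, q i * star (q j) = q j * star (q i)) ->
  (forall i j, star (q i) * q j = star (q j) * q i) ->
  forall l m, kvars s q l * kvars s q m = kvars s q m * kvars s q l.
Proof.
move=> q1 q2; case/mxvec_indexP => i j; case/mxvec_indexP => l m.
by rewrite !kvarsE -!scalerAl -!scalerAr quat_rel_comm.
Qed.

Local Notation V i j := (PVar (mxvec_index i j)).

(** The equations of [is_quat] for the scaled matrix: the first two kinds are homogeneous, and the
    trace becomes [s]. *)
Definition quat_rels (s : R)
    (i : ('I_4 * 'I_4) + ('I_4 * 'I_4 * 'I_4 + unit)) : pexp R (4 * 4) :=
  match i with
  | inl (i, j) => PAdd (V i j) (PMul (PConst (-1)) (V j i))
  | inr (inl (i, j, l)) =>
      PAdd (PMul (V i i) (V j l)) (PMul (PConst (-1)) (PMul (V i j) (V i l)))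
  | inr (inr _) => PAdd (psum [seq V i i | i <- enum 'I_4]) (PConst (- (s%:C)%C))
  end.

Lemma quat_rels_zeros s (v : 'rV[R]_(4 * 4)) : 0 < s ->
  (forall i, ceval (fun l => v ord0 l) (quat_rels s i) = 0) ->
  exists x : SO3 R, forall l, v ord0 l = quat_coord s l x.
Proof.
move=> s0 h; have s0' : s != 0 by rewrite gt_eqF.
have inj (x y : R) : (x%:C + -1 * y%:C = 0)%C -> x = y.
  by rewrite mulN1r => /eqP; rewrite subr_eq0 => /eqP [].
pose K := s^-1 *: vec_mx v.
have vE i j : v ord0 (mxvec_index i j) = s * K i j.
  by rewrite !mxE mulVKf.
have hK : is_quat K.
  split.
  - move=> i j; have := h (inl (i, j)); rewrite /ceval /= /GRing.scale /= mulr1 => /inj.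
    by rewrite !vE => /(mulfI s0').
  - have := h (inr (inr tt)); rewrite /ceval /= peval_psum big_map big_enum /= /GRing.scale /= mulr1.
    under eq_bigr do rewrite vE; rewrite -rmorph_sum /= -mulr_sumr.
    move/eqP; rewrite subr_eq0 => /eqP [] /(congr1 (fun x => s^-1 * x)).
    by rewrite mulKf // mulVf.
  - move=> i j l; have := h (inr (inl (i, j, l))); rewrite /ceval /= /GRing.scale /= mulr1.
    rewrite -!rmorphM /= => /inj; rewrite !vE mulrACA [RHS]mulrACA.
    by apply: mulfI; rewrite mulf_neq0.
have [q q1 Kq] := quat_ex hK; have [hM qK] := rot_quat q1 Kq.
exists (@exist _ _ (rot K) (mem_set hM)) => l.
case/mxvec_indexP: l => i j.
by rewrite vE /quat_coord mxvecE /= set_valE /= qK.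
Qed.

Lemma quat_bound s (q : 'I_4 -> A) e M :
  (forall i j, q i * star (q j) = q j * star (q i)) ->
  (forall i j, star (q i) * q j = star (q j) * q i) ->
  \sum_i star (q i) * q i = 1 -> 0 < s ->
  (forall l, cnorm (kvars s q l) <= 2^-1) -> 0 <= M ->
  (forall x : SO3 R, normc (ceval (fun l => quat_coord s l x) e) <= M) ->
  cnorm (peval (kvars s q) e) <= M.
Proof.
move=> q1 q2 qs s0 ks M0 hM.
have [|x y [l _ <-] [m _ <-]|C hC kC] := @comm_cstar_subalgebra_ex R A (range (kvars s q)).
- by move=> _ [l _ <-]; exists l => //; rewrite kvars_star.
- exact: kvars_comm.
apply: (@zeros_bound _ _ _ _ C _ (quat_rels s)) => // [l|l|[[i j]|[[[i j] l]|[]]]|v cv hv].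
- by apply: kC; exists l.
- exact: kvars_star.
- by rewrite /= !kvarsE scaleN1r mulN1r quat_rel_sym // subrr.
- rewrite /= !kvarsE scaleN1r mulN1r -!scalerAl -!scalerAr.
  by rewrite (quat_rel_mid q1) quat_rel_sym // subrr.
- rewrite /= peval_psum big_map big_enum /=; under eq_bigr do rewrite kvarsE.
  by rewrite -scaler_sumr qs scaleNr subrr.
have [x hx] := quat_rels_zeros s0 hv.
by rewrite (_ : (fun i => v ord0 i) = fun l => quat_coord s l x) //; apply/funext.
Qed.

End QuaternionBound.


(** * Characters given by unit quaternions *)

Section Characters.
Local Open Scope classical_set_scope.
Variables (R : realType) (A : cstarAlgType R) (u : 'M[A]_2).

(** This is a + i (b sigma_1 + c sigma_2 + d sigma_3), so that its [qcoord] are a, b, c, d. *)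
Definition su2 (a b c d : R) : 'M[R[i]^o]_2 := \matrix_(i, j)
  nth 0 (nth [::] [:: [:: Complex a d; Complex c b];
                      [:: Complex (- c) b; Complex a (- d)]] i) j.

Lemma su2_unitary a b c d : a ^+ 2 + b ^+ 2 + c ^+ 2 + d ^+ 2 = 1 ->
  unitary_mx (su2 a b c d) /\ unitary_mx (conj_mx (su2 a b c d)).
Proof.
move=> q1; have e (z : R[i]) : z = Complex (a ^+ 2 + b ^+ 2 + c ^+ 2 + d ^+ 2) 0 -> z = 1.
  by rewrite q1.
split; split; apply/matrixP; apply: ord2_ind; apply: ord2_ind; rewrite !mxE sum_ord2 !mxE /=;
  rewrite ?mulr1n ?mulr0n; first [apply: e | idtac];
  by apply/eqP; rewrite eq_complex /=; apply/andP; split; apply/eqP; ring.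
Qed.

(** The character comes from either of the two quaternions over x. Their opposite signs disappear in
    the products K_mn. *)
Lemma character_ex (Au : is_Au u) (x : SO3 R) :
  exists f : {lrmorphism A -> R[i]^o}, star_morphism f /\
    forall s l, f (kvars s (qcoord u) l) = ((quat_coord s l x)%:C)%C.
Proof.
have [q q1 Kq] := quat_ex (quat_SO3 (set_valP x)).
have [v1 v2] := su2_unitary (etrans (esym (sum_ord4 (fun i => q i ^+ 2))) q1).
have [_ _ /(_ _ _ v1 v2) [f [fs fu _]]] := Au.
have fuE i j : f (u i j) = su2 (q (o4 0)) (q (o4 1)) (q (o4 2)) (q (o4 3)) i j.
  by rewrite -fu mxE.
have fq m : f (qcoord u m) = ((q m)%:C)%C.
  rewrite /qcoord linearZ /= /GRing.scale /=.
  suff -> : f (pauli u m) = (if odd m then 2 * 'i%C else 2) * ((q m)%:C)%C.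
    rewrite mulrA /qscale; case: (odd m).
      by rewrite mulNr mulrA divfK ?pnatr_eq0 // -expr2 sqr_i opprK mul1r.
    by rewrite mulVf ?pnatr_eq0 // mul1r.
  have -> : 2%:R = (2%:R)%:C%C :> R[i] by rewrite rmorph_nat.
  move: m; apply: ord4_ind; rewrite /pauli /= ?rmorphD /= ?rmorphN /= !fuE !mxE /=;
    by apply/eqP; rewrite eq_complex /=; apply/andP; split; apply/eqP; ring.
exists f; split=> // s l; case/mxvec_indexP: l => i j.
rewrite kvarsE /quat_coord mxvecE Kq linearZ /= rmorphM /= fs !fq /GRing.scale /=.
rewrite !rmorphM /=; congr (_ * (_ * _)).
exact: conj_real.
Qed.

End Characters.

(** * Passing between a representation and its complement of the trivial one *)

Section SubalgebraClosure.
Local Open Scope classical_set_scope.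
Variables (R : realType) (A : cstarAlgType R).
Implicit Types (X C : set A).

Lemma closure_cstar_subalgebra X : X 0 ->
  (forall a b, X a -> X b -> X (a + b)) ->
  (forall (k : R[i]) a, X a -> X (k *: a)) ->
  (forall a b, X a -> X b -> X (a * b)) ->
  (forall a, X a -> X (star a)) -> cstar_subalgebra (cnorm_closure X).
Proof.
move=> X0 XD XZ XM Xs; split; first by move=> a ha; apply: cnorm_closureP.
split.
- exact: subset_cnorm_closure.
- move=> a b ha hb e e0; have e20 : 0 < e / 2 by rewrite divr_gt0.
  have [c Xc ac] := ha _ e20; have [d Xd bd] := hb _ e20.
  exists (c + d); first exact: XD.
  rewrite opprD addrACA (splitr e).
  exact: le_lt_trans (ler_cnormD _ _) (ltrD ac bd).
- move=> k a ha e e0; have k0 : 0 < Normc.normc k + 1 by rewrite ltr_wpDl ?normc_ge0.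
  have [c Xc ac] := ha _ (divr_gt0 e0 k0); exists (k *: c); first exact: XZ.
  rewrite -scalerBr cnormZ; apply: le_lt_trans (_ : (Normc.normc k + 1) * cnorm (a - c) < e).
    by rewrite ler_wpM2r ?cnorm_ge0 // lerDl.
  by rewrite mulrC -ltr_pdivlMr.
- move=> a b ha hb e e0; have e20 : 0 < e / 2 by rewrite divr_gt0.
  have a0 : 0 < cnorm b + 1 by rewrite ltr_wpDl ?cnorm_ge0.
  have [c Xc ac] := ha _ (divr_gt0 e20 a0).
  (* The approximant of b is chosen after [c], since its error gets multiplied by the norm of c. *)
  have c0 : 0 < cnorm c + 1 by rewrite ltr_wpDl ?cnorm_ge0.
  have [d Xd bd] := hb _ (divr_gt0 e20 c0).
  exists (c * d); first exact: XM.
  have -> : a * b - c * d = (a - c) * b + c * (b - d).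
    by rewrite mulrBl mulrBr addrA subrK.
  apply: le_lt_trans (ler_cnormD _ _) _; rewrite (splitr e); apply: ltrD.
    apply: le_lt_trans (ler_cnormM _ _) _.
    apply: le_lt_trans (_ : cnorm (a - c) * (cnorm b + 1) < _).
      by rewrite ler_wpM2l ?cnorm_ge0 // lerDl.
    by rewrite -ltr_pdivlMr.
  apply: le_lt_trans (ler_cnormM _ _) _.
  apply: le_lt_trans (_ : (cnorm c + 1) * cnorm (b - d) < _).
    by rewrite ler_wpM2r ?cnorm_ge0 // lerDl.
  by rewrite mulrC -ltr_pdivlMr.
- move=> a ha e e0; have [c Xc ac] := ha e e0; exists (star c); first exact: Xs.
  by rewrite -starB cnorm_star.
Qed.

Lemma cstar_subalgebra_sum C (I : Type) (r : seq I) (F : I -> A) :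
  cstar_subalgebra C -> (forall i, C (F i)) -> C (\sum_(i <- r) F i).
Proof. by move=> [_ [C0 CD _ _ _]] hF; elim/big_ind: _. Qed.

Lemma scalar_emb_mul n (S T : 'M[R[i]]_n) :
  scalar_emb A (S *m T) = scalar_emb A S *m scalar_emb A T.
Proof.
apply/matrixP => i j; rewrite !mxE scaler_suml; apply: eq_bigr => k _.
by rewrite !mxE mulr_algl scalerA.
Qed.

Lemma scalar_emb1 n : scalar_emb A (1%:M : 'M[R[i]]_n) = 1%:M.
Proof.
by apply/matrixP => i j; rewrite !mxE; case: eqP => _; rewrite ?scale1r ?scale0r.
Qed.

Lemma mem_scalar_emb_mul C n (S T : 'M[R[i]]_n) (v : 'M[A]_n) :
  cstar_subalgebra C -> (forall i j, C (v i j)) ->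
  forall i j, C ((scalar_emb A S *m v *m scalar_emb A T) i j).
Proof.
move=> hC Cv i j; have CZ (k : R[i]) a : C a -> C (k *: a) by case: hC => _ [_ _ + _ _]; apply.
rewrite mxE; apply: cstar_subalgebra_sum => // l; rewrite !mxE mulr_algr; apply/CZ.
by apply: cstar_subalgebra_sum => // m; rewrite mxE mulr_algl; apply: CZ.
Qed.

Section MinusTrivial.
Variables (n : nat) (w : 'M[A]_(1 + n)) (r : 'M[A]_n) (S : 'M[R[i]]_(1 + n)).
Hypotheses (SU : S \in unitmx)
  (wS : w *m scalar_emb A S = scalar_emb A S *m block_mx 1%:M 0 0 r).

Lemma block_conj : block_mx 1%:M 0 0 r =
  scalar_emb A (invmx S) *m w *m scalar_emb A S.
Proof. by rewrite -mulmxA wS mulmxA -scalar_emb_mul mulVmx // scalar_emb1 mul1mx. Qed.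

Lemma conj_block : w =
  scalar_emb A S *m block_mx 1%:M 0 0 r *m scalar_emb A (invmx S).
Proof. by rewrite -wS -mulmxA -scalar_emb_mul mulmxV // scalar_emb1 mulmx1. Qed.

Lemma rep_mem C : cstar_subalgebra C -> (forall i j, C (w i j)) ->
  forall i j, C (r i j).
Proof.
move=> hC Cw i j.
have -> : r i j = block_mx 1%:M 0 0 r (rshift 1 i) (rshift 1 j) by rewrite block_mxEdr.
by rewrite block_conj; apply: mem_scalar_emb_mul.
Qed.

Lemma coefficients_mem C : cstar_subalgebra C -> (forall i j, C (r i j)) ->
  coefficients r `<=` C.
Proof.
move=> hC Cr _ [c ->]; apply: cstar_subalgebra_sum => // i.
apply: cstar_subalgebra_sum => // j.
by case: hC => _ [_ _ + _ _]; apply.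
Qed.

Lemma mem_coefficients i j : coefficients r (r i j).
Proof.
exists (delta_mx i j); rewrite (bigD1 i) //= (bigD1 j) //= mxE !eqxx scale1r.
rewrite big1 ?addr0 => [|l lj]; last by rewrite mxE (negPf lj) andbF scale0r.
rewrite big1 ?addr0 // => l li; rewrite big1 // => m _.
by rewrite mxE (negPf li) scale0r.
Qed.

(* A column of w S = S (1 + r) other than the first is made of combinations of
   the entries of r; as w is unitary, its squared norm is that of the
   corresponding column of S, a nonzero scalar. *)
Lemma rep_mem1 C (i0 : 'I_n) : cstar_subalgebra C -> (conj_mx w)^T *m w = 1%:M ->
  (forall i j, C (r i j)) -> C 1.
Proof.
move=> hC ww Cr; have [_ [C0 CD CZ CM Cs]] := hC.
pose e := rshift 1 i0; pose y m := (w *m scalar_emb A S) m e.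
have Cy m : C (y m).
  rewrite /y wS mxE; apply: cstar_subalgebra_sum => // k.
  rewrite mxE mulr_algl; apply/CZ; rewrite /e.
  case: (split_ordP k) => l ->; first by rewrite block_mxEur mxE.
  by rewrite block_mxEdr.
pose g := \sum_k ((S k e)^*)%R * S k e.
have yE m : y m = \sum_k S k e *: w m k.
  by rewrite /y mxE; apply: eq_bigr => k _; rewrite mxE mulr_algr.
have yy : \sum_m star (y m) * y m = g%:A.
  under eq_bigr => m _ do rewrite yE star_sum mulr_suml.
  rewrite exchange_big /= /g scaler_suml; apply: eq_bigr => k _.
  under eq_bigr => m _ do rewrite starZ -scalerAl mulr_sumr.
  rewrite -scaler_sumr exchange_big /= -scalerA; congr (_ *: _).
  have col l : \sum_m star (w m k) * w m l = (k == l)%:R.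
    have /matrixP/(_ k l) := ww; rewrite !mxE => <-; apply: eq_bigr => m _.
    by rewrite !mxE.
  under eq_bigr => l _.
    under eq_bigr => m _ do rewrite -scalerAr.
    rewrite -scaler_sumr col; over.
  rewrite (bigD1 k) //= eqxx big1 ?addr0 // => l lk.
  by rewrite eq_sym (negPf lk) scaler0.
(* An invertible matrix has no zero column. *)
have g0 : g != 0.
  have : \sum_k `|S k e| ^+ 2 != 0.
    apply: contraL SU => /eqP/psumr_eq0P h; rewrite unitmxE unitfE negbK.
    rewrite (expand_det_col _ e) big1 // => k _.
    have /eqP := h (fun _ _ => exprn_ge0 2 (normr_ge0 _)) k isT.
    by rewrite sqrf_eq0 normr_eq0 => /eqP ->; rewrite mul0r.
  apply: contra => /eqP g0; apply/eqP; rewrite -[RHS]g0 /g.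
  by apply: eq_bigr => k _; rewrite normCKC.
have -> : (1 : A) = g^-1 *: \sum_m star (y m) * y m.
  by rewrite yy scalerA mulVf // scale1r.
by apply: CZ; apply: cstar_subalgebra_sum => // m; apply: CM => //; apply: Cs.
Qed.

Lemma rep_mem_conj C : cstar_subalgebra C -> C 1 -> (forall i j, C (r i j)) ->
  forall i j, C (w i j).
Proof.
move=> hC C1 Cr i j; have [_ [C0 _ _ _ _]] := hC.
rewrite conj_block; apply: mem_scalar_emb_mul => // {}i {}j.
case: (split_ordP i) => k ->; case: (split_ordP j) => l ->.
- by rewrite block_mxEul mxE; case: eqP.
- by rewrite block_mxEur mxE.
- by rewrite block_mxEdl mxE.
- by rewrite block_mxEdr.
Qed.

End MinusTrivial.
End SubalgebraClosure.

(** * Continuity of complex functions through real and imaginary parts *)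

Section ContinuousComplex.
Local Open Scope classical_set_scope.
Variables (R : realType) (X : topologicalType).
Local Notation normc := (@Normc.normc R).
Implicit Types f : X -> (R[i] : numFieldType).

Lemma continuous_normcP f : continuous f <->
  forall x e, 0 < e -> \forall y \near x, normc (f x - f y) < e.
Proof.
have nE (z : R[i]) (e : R) : (`|z| < (e%:C)%C) = (normc z < e) by rewrite ltcR.
split=> [fc x e e0|h x].
  have /cvgrPdist_lt/(_ (e%:C)%C) := fc x; rewrite ltcR => /(_ e0).
  by apply: filterS => y; rewrite nE.
(* The radius is a complex number here; being positive in the order of [R[i]] forces its imaginary
   part to be zero. *)
apply/cvgrPdist_lt => -[e e']; rewrite ltcE /= => /andP[/eqP -> e0].
by have := h x e e0; apply: filterS => y; rewrite -nE.
Qed.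

Lemma continuous_Re f : continuous f -> continuous (fun x => complex.Re (f x)).
Proof.
move=> /continuous_normcP h x; apply/cvgrPdist_lt => e e0.
have := h x e e0; apply: filterS => y; apply: le_lt_trans.
by apply: le_trans (Re_le_normc _); case: (f x) (f y) => a b [c d].
Qed.

Lemma continuous_Im f : continuous f -> continuous (fun x => complex.Im (f x)).
Proof.
move=> /continuous_normcP h x; apply/cvgrPdist_lt => e e0.
have := h x e e0; apply: filterS => y; apply: le_lt_trans.
by apply: le_trans (Im_le_normc _); case: (f x) (f y) => a b [c d].
Qed.

Lemma continuous_ReIm f : continuous (fun x => complex.Re (f x)) ->
  continuous (fun x => complex.Im (f x)) -> continuous f.
Proof.
move=> hr hi; apply/continuous_normcP => x e e0.
have /cvgrPdist_lt/(_ (e / 2)) := hr x; rewrite divr_gt0 // => /(_ isT) h1.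
have /cvgrPdist_lt/(_ (e / 2)) := hi x; rewrite divr_gt0 // => /(_ isT) h2.
near=> y; apply: le_lt_trans (normc_le_ReIm _) _; rewrite (splitr e).
have E : (complex.Re (f x - f y) = complex.Re (f x) - complex.Re (f y)) *
         (complex.Im (f x - f y) = complex.Im (f x) - complex.Im (f y)).
  by case: (f x) (f y) => a b [c d].
rewrite !E; apply: ltrD; near: y; [exact: h1|exact: h2].
Unshelve. all: by end_near.
Qed.

Lemma continuous_uniform_limit f :
  (forall e : R, 0 < e -> exists2 g : X -> (R[i] : numFieldType), continuous g &
     forall x, normc (f x - g x) <= e) -> continuous f.
Proof.
move=> h; apply/continuous_normcP => x e e0.
have e40 : 0 < e / 4 by rewrite divr_gt0.
have [g gc fg] := h _ e40; have /continuous_normcP/(_ x _ e40) := gc.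
apply: filterS => y gxy.
have -> : f x - f y = (f x - g x) + ((g x - g y) - (f y - g y)).
  by rewrite opprB !addrA !subrK.
apply: le_lt_trans (normc_add _ _) _.
have := normc_add (g x - g y) (- (f y - g y)); rewrite normc_opp.
have := fg x; have := fg y; move: gxy; move: (normc _) (normc _) (normc _) (normc _) => a b c d.
lra.
Qed.

End ContinuousComplex.

(** * The algebra generated by the K_mn is C(SO(3)) *)

Section Isomorphism.
Local Open Scope classical_set_scope.
Variables (R : realType) (A : cstarAlgType R) (u : 'M[A]_2) (Au : is_Au u).
Local Notation normc := (@Normc.normc R).
Local Notation q := (qcoord u).

Lemma kvars_small : exists2 s : R, 0 < s & forall l, cnorm (kvars s q l) <= 2^-1.
Proof.
pose k l := cnorm (kvars 1 q l); pose M := \sum_l k l + 1.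
have M0 : 0 < M by rewrite ltr_wpDl // sumr_ge0 // => l _; apply: cnorm_ge0.
exists (2^-1 / M) => [|l]; first by rewrite divr_gt0.
have -> : kvars (2^-1 / M) q l = ((2^-1 / M)%:C)%C *: kvars 1 q l.
  by rewrite /kvars scale1r.
rewrite cnormZ normc_real ger0_norm ?divr_ge0 ?invr_ge0 ?(ltW M0) //.
rewrite mulrAC ler_pdivrMr // ler_wpM2l ?invr_ge0 // -/(k l) /M (bigD1 l) //=.
by rewrite -addrA lerDl addr_ge0 // sumr_ge0 // => j _; apply: cnorm_ge0.
Qed.

Definition quat_algebra s : set A := cnorm_closure (range (peval (kvars s q))).

Lemma kvars_self_comm s : (forall l, star (kvars s q l) = kvars s q l) /\
  (forall l m, kvars s q l * kvars s q m = kvars s q m * kvars s q l).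
Proof.
have [uU uU' _] := Au; have q1 := qcoord_left uU uU'; have q2 := qcoord_right uU uU'.
by split=> [l|]; [apply: kvars_star|apply: kvars_comm].
Qed.

Lemma quat_algebra_cstar s : cstar_subalgebra (quat_algebra s).
Proof.
have [sk ck] := kvars_self_comm s; apply: closure_cstar_subalgebra.
- by exists (PConst 0) => //=; rewrite scale0r.
- by move=> _ _ [e _ <-] [e' _ <-]; exists (PAdd e e').
- by move=> k _ [e _ <-]; exists (PMul (PConst k) e) => //=; rewrite mulr_algl.
- by move=> _ _ [e _ <-] [e' _ <-]; exists (PMul e e').
- by move=> _ [e _ <-]; exists (pconj e) => //; rewrite star_peval.
Qed.

(** One character is chosen over each point, and an element is sent to the function of its values.
    [chi_le] and [bound] are the two halves of the isometry on polynomials: the first makes the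
    values continuous, the second gives injectivity and surjectivity. *)
Lemma quat_algebra_iso s : 0 < s -> (forall l, cnorm (kvars s q l) <= 2^-1) ->
  isomorphic_to_C (quat_algebra s) (set_type (SO3 R)).
Proof.
move=> s0 ks; have [uU uU' _] := Au.
have /choice[chi chiP] := character_ex Au.
pose ev e (x : SO3 R) : R[i] := ceval (fun l => quat_coord s l x) e.
have chi_ev e x : chi x (peval (kvars s q) e) = ev e x.
  rewrite peval_rmorph /ev /ceval; congr (peval _ _); apply/funext => l /=.
  by case: (chiP x) => _ ->.
have chi_le a x : normc (chi x a) <= cnorm a by apply: star_morphism_contractive.
have bound e M : 0 <= M -> (forall x, normc (ev e x) <= M) ->
    cnorm (peval (kvars s q) e) <= M.
  move=> M0 hM; apply: quat_bound => //.
  - exact: qcoord_left.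
  - exact: qcoord_right.
  - exact: qcoord_sum.
have ev_cont e : continuous (ev e : SO3 R -> (R[i] : numFieldType)).
  have [h1 h2] := @ceval_continuous R (4 * 4) (SO3 R) (quat_coord s) e
    (@quat_coord_continuous R s).
  exact: continuous_ReIm.
have BD a b : quat_algebra s a -> quat_algebra s b -> quat_algebra s (a - b).
  have [_ [_ BD BZ _ _]] := quat_algebra_cstar s.
  by move=> ha hb; rewrite -scaleN1r; apply/BD/BZ.
have chiB x a b : chi x (a - b) = chi x a - chi x b := rmorphB (chi x) a b.
(* A polynomial close to [a] takes small values everywhere, hence has small norm by [bound], and so
   has [a]. *)
have zero a : quat_algebra s a -> (forall x, chi x a = 0) -> a = 0.
  move=> Ba ha; apply/cnorm_eq0/eqP; rewrite eq_le cnorm_ge0 andbT.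
  apply: le_of_lt_add => eps eps0; rewrite add0r.
  have [_ [e _ <-] ae] := Ba _ (divr_gt0 eps0 (ltr0Sn R 1)).
  rewrite -(subrK (peval (kvars s q) e) a) (splitr eps).
  apply: le_lt_trans (ler_cnormD _ _) _; apply: ltr_leD => //.
  apply: bound => [|x]; first by rewrite divr_ge0 // ltW.
  rewrite -chi_ev; have -> : chi x (peval (kvars s q) e) = - chi x (a - peval (kvars s q) e).
    by rewrite chiB ha sub0r opprK.
  by rewrite normc_opp; apply: le_trans (chi_le _ _) (ltW ae).
exists (fun a x => chi x a); split.
- split.
  + move=> a Ba /=; apply: continuous_uniform_limit => e e0.
    have [_ [p _ <-] ap] := Ba e e0; exists (ev p) => // x.
    by rewrite -chi_ev -chiB; apply: le_trans (chi_le _ _) (ltW ap).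
  + move=> a b; rewrite !inE => Ba Bb ab; apply/eqP; rewrite -subr_eq0; apply/eqP.
    apply: zero; first exact: BD.
    by move=> x; rewrite chiB; have /(congr1 (@^~ x)) /= -> := ab; rewrite subrr.
  + move=> f /= fc.
    have dens n : exists e, forall x, normc (f x - ev e x) < n.+1%:R^-1.
      apply: (@polynomial_density R (SO3 R) (4 * 4) (quat_coord s)) => //.
      * exact: setT_SO3_compact.
      * exact: quat_coord_continuous.
      * by move=> x y; apply: quat_coord_inj; rewrite gt_eqF.
      * exact: continuous_Re.
      * exact: continuous_Im.
    have [p hp] := choice dens; pose v n := peval (kvars s q) (p n).
    have small (e : R) : 0 < e -> exists N, forall n, (N <= n)%N -> n.+1%:R^-1 < e.
      move=> e0; exists (Num.bound e^-1) => n Nn.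
      rewrite invf_plt ?posrE // ; apply: lt_le_trans (archi_boundP _) _.
        by rewrite invr_ge0 ltW.
      by rewrite ler_nat; apply: leq_trans Nn _.
    have vB n : quat_algebra s (v n) by apply: subset_cnorm_closure; exists (p n).
    (* Polynomials converging uniformly to f are uniformly Cauchy on SO(3); by [bound] they are
       Cauchy in [A], and their limit is the preimage of f. *)
    have [|l hl] := @cnorm_limit R A v.
      move=> e e0; have [N hN] := small _ (divr_gt0 e0 (ltr0Sn R 3)).
      exists N => m n Nm Nn.
      have -> : v m - v n = peval (kvars s q) (PAdd (p m) (PMul (PConst (-1)) (p n))).
        by rewrite /= scaleN1r mulN1r.
      apply: (@le_lt_trans _ _ (e / 2)); last by rewrite ltr_pdivrMr // ltr_pMr // ltr1n.
      apply: bound => [|x]; first by rewrite divr_ge0 // ltW.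
      have -> : ev (PAdd (p m) (PMul (PConst (-1)) (p n))) x =
          (f x - ev (p n) x) - (f x - ev (p m) x).
        rewrite /ev /ceval /= /GRing.scale /= mulr1 mulN1r.
        by rewrite opprB [RHS]addrC addrA subrK.
      apply: le_trans (normc_add _ _) _; rewrite normc_opp.
      have := lt_trans (hp m x) (hN m Nm); have := lt_trans (hp n x) (hN n Nn).
      move: (normc _) (normc _) => a b; lra.
    exists l.
      apply: cnorm_closureP => e e0; have [N hN] := hl e e0.
      by exists (v N); [exact: vB|rewrite cnormB_sym hN].
    apply/funext => x; apply/eqP; rewrite -subr_eq0; apply/eqP/Normc.eq0_normc/eqP.
    rewrite eq_le normc_ge0 andbT; apply: le_of_lt_add => e e0; rewrite add0r.
    have e20 : 0 < e / 2 by rewrite divr_gt0.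
    have [N hN] := hl _ e20; have [N' hN'] := small _ e20.
    pose n := maxn N N'.
    have -> : chi x l - f x = - (chi x (v n - l) + (f x - ev (p n) x)).
      by rewrite chiB chi_ev opprD !opprB addrA subrK.
    rewrite normc_opp; apply: le_lt_trans (normc_add _ _) _; rewrite (splitr e).
    apply: ltrD; first by apply: le_lt_trans (chi_le _ _) (hN n (leq_maxl _ _)).
    exact: lt_trans (hp n x) (hN' n (leq_maxr _ _)).
- by move=> a b _ _ x; rewrite rmorphD.
- by move=> k a _ x; rewrite linearZ.
- by move=> a b _ _ x; rewrite rmorphM.
- by move=> a _ x; case: (chiP x) => /(_ a).
Qed.

End Isomorphism.

Lemma conj_mxK (R : realType) (A : cstarAlgType R) m n (v : 'M[A]_(m, n)) :
  conj_mx (conj_mx v) = v.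
Proof. by apply/matrixP => i j; rewrite !mxE starK. Qed.

(** * Coefficients of the three-dimensional representations *)

Section TensorRepresentation.
Local Open Scope classical_set_scope.
Variables (R : realType) (A : cstarAlgType R).

(** The defining relations are symmetric in u and its conjugate; this lets one computation serve
    both representations. *)
Lemma is_Au_conj n (u : 'M[A]_n) : is_Au u -> is_Au (conj_mx u).
Proof.
move=> [uU uU' univ]; split; rewrite ?conj_mxK // => B v vU vU'.
have [|f [fs fu funiq]] := univ B (conj_mx v) vU'; first by rewrite conj_mxK.
exists f; split=> // [|g gs gu].
  by apply/matrixP => i j; have /matrixP/(_ i j) := fu; rewrite !mxE fs => ->; rewrite starK.
apply: funiq => //; apply/matrixP => i j; have /matrixP/(_ i j) := gu.
by rewrite !mxE gs => <-; rewrite starK.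
Qed.

Lemma mem_star_mul_sum (C : set A) (I J : Type) (s : seq I) (t : seq J)
    (F : I -> A) (G : J -> A) : cstar_subalgebra C ->
  (forall i j, C (star (F i) * G j)) ->
  C (star (\sum_(i <- s) F i) * \sum_(j <- t) G j).
Proof.
move=> hC h; rewrite star_sum mulr_suml; apply: cstar_subalgebra_sum => // i.
by rewrite mulr_sumr; apply: cstar_subalgebra_sum.
Qed.

Lemma mem_star_mul_scale (C : set A) (k l : R[i]) a b : cstar_subalgebra C ->
  C (star a * b) -> C (star (k *: a) * (l *: b)).
Proof.
move=> [_ [_ _ CZ _ _]] h; rewrite starZ -scalerAl -scalerAr.
by apply/CZ/CZ.
Qed.

Lemma peval_mem_cstar (C : set A) n (k : 'I_n -> A) e : cstar_subalgebra C ->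
  C 1 -> (forall i, C (k i)) -> C (peval k e).
Proof.
move=> [_ [_ CD CZ CM _]] C1 Ck.
by elim: e => [c|j|e1 h1 e2 h2|e1 h1 e2 h2] //=; [apply: CZ|apply: CD|apply: CM].
Qed.

Variables (u : 'M[A]_2) (Au : is_Au u).
Local Notation w := (tensmx (conj_mx u) u).
Local Notation q := (qcoord u).

Lemma tens_entry i j k l :
  w (mxtens_index (i, k)) (mxtens_index (j, l)) = star (u i j) * u k l.
Proof. by rewrite tensmxE mxE. Qed.

Lemma tens_unitary : (conj_mx w)^T *m w = 1%:M.
Proof.
have [uU uU' _] := Au; have [_ h1] := unitary_entries uU; have [_ h2] := unitary_entries uU'.
apply/matrixP => x y; case: (mxtens_indexP x) => i k; case: (mxtens_indexP y) => j l.
have row_sum : \sum_a u a i * star (u a j) = (i == j)%:R.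
  by rewrite sum_ord2 -h2 !mxE !starK.
have col_sum : \sum_b star (u b k) * u b l = (k == l)%:R by rewrite sum_ord2.
have trE z t : (conj_mx w)^T z t = star (w t z) by rewrite mxE /conj_mx mxE.
rewrite mxE (reindex (@mxtens_index 2 2)) /=; last first.
  by exists (@mxtens_unindex 2 2) => z _; [apply: mxtens_indexK|apply: mxtens_unindexK].
rewrite (eq_bigr (fun p => star (u p.2 k) * (u p.1 i * star (u p.1 j)) * u p.2 l)); last first.
  by move=> [a b] _; rewrite trE !tens_entry starM starK !mulrA.
rewrite -(pair_bigA _ (fun a b => star (u b k) * (u a i * star (u a j)) * u b l)) /=.
(* The entries of the conjugate factor stand in the middle of the product, so the sum over their row
   index is done first, by unitarity of [conj_mx u]; unitarity of [u] then handles the outer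
   pair. *)
rewrite exchange_big /=.
rewrite (eq_bigr (fun b => (i == j)%:R * (star (u b k) * u b l))); last first.
  by move=> b _; rewrite -mulr_suml -mulr_sumr row_sum mulr_natr mulrnAl mulr_natl.
rewrite -mulr_sumr col_sum mxE (can_eq (@mxtens_indexK 2 2)) xpair_eqE.
by case: (i == j); rewrite ?mul1r ?mul0r.
Qed.

Lemma tens_mem (C : set A) : cstar_subalgebra C ->
  (forall m n, C (star (q m) * q n)) -> forall i j, C (w i j).
Proof.
move=> hC hq x y; case: (mxtens_indexP x) => i k; case: (mxtens_indexP y) => j l.
rewrite tens_entry; have [s ->] := qcoord_entry u i j; have [t ->] := qcoord_entry u k l.
by apply: mem_star_mul_sum => // m n; apply: mem_star_mul_scale.
Qed.

Lemma qcoord_mem (C : set A) : cstar_subalgebra C ->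
  (forall i j, C (w i j)) -> forall m n, C (star (q m) * q n).
Proof.
move=> hC hw m n; have [s ->] := qcoord_comb u m; have [t ->] := qcoord_comb u n.
apply: mem_star_mul_sum => // i k; apply: mem_star_mul_sum => // j l.
by apply: mem_star_mul_scale => //; rewrite -tens_entry.
Qed.

(** A C*-subalgebra containing the K_mn contains the coefficients of [r], which gives commutation
    and one inclusion; conversely the coefficients give back the unit, then the tensor product, then
    the K_mn. *)
Lemma rep_coefficients (r : 'M[A]_3) (S : 'M[R[i]]_(1 + 3)) : S \in unitmx ->
  (w : 'M[A]_(1 + 3)) *m scalar_emb A S = scalar_emb A S *m block_mx 1%:M 0 0 r ->
  (forall a b, coefficients r a -> coefficients r b -> a * b = b * a) /\
  isomorphic_to_C (cstar_generated (coefficients r)) (set_type (SO3 R)).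
Proof.
move=> SU wS; have [s s0 ks] := kvars_small u.
have [sk ck] := kvars_self_comm Au s.
have sV : (s%:C)%C != 0 :> R[i] by apply/eqP => -[] s00; move: s0; rewrite s00 ltxx.
have q_kvars C m n : cstar_subalgebra C -> (forall l, C (kvars s q l)) -> C (star (q m) * q n).
  move=> [_ [_ _ CZ _ _]] Ck.
  have -> : star (q m) * q n = ((s%:C)%C)^-1 *: kvars s q (mxvec_index m n).
    by rewrite kvarsE scalerA mulVf // scale1r.
  exact: CZ.
have coefC C : cstar_subalgebra C -> (forall l, C (kvars s q l)) -> coefficients r `<=` C.
  move=> hC Ck; apply: coefficients_mem => //; apply: (rep_mem SU wS) => //.
  by apply: tens_mem => // m n; apply: q_kvars.
split.
  have [|x y [l _ <-] [m _ <-]|C hC kC] := @comm_cstar_subalgebra_ex R A (range (kvars s q)).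
  - by move=> _ [l _ <-]; exists l.
  - exact: ck.
  have [hC' _ cC] := hC; move=> a b ha hb; apply: cC; apply: (coefC C hC') => // l;
    by apply: kC; exists l.
suff -> : cstar_generated (coefficients r) = quat_algebra u s by exact: quat_algebra_iso.
apply/seteqP; split.
  apply: smallest_sub; first exact: quat_algebra_cstar.
  apply: coefC; first exact: quat_algebra_cstar.
  by move=> l; apply: subset_cnorm_closure; exists (PVar l).
move=> a ha C [hC rC]; have [Ccl _] := hC.
have Cr i j : C (r i j) by apply: rC; apply: mem_coefficients.
(* [cstar_subalgebra] does not include the unit, and both the trivial block of the tensor product
   and the constants of polynomials call for it. *)
have C1 : C 1 by apply: (rep_mem1 SU wS ord0) => //; apply: tens_unitary.
have Cq := qcoord_mem hC (rep_mem_conj SU wS hC C1 Cr).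
apply: Ccl => e e0; have [_ [p _ <-] ap] := ha e e0.
exists (peval (kvars s q) p) => //; apply: peval_mem_cstar => // l.
case/mxvec_indexP: l => i j; rewrite kvarsE; have [_ [_ _ CZ _ _]] := hC.
exact: CZ.
Qed.

End TensorRepresentation.

Theorem theorem5 (R : realType) (A : cstarAlgType R) (u : 'M[A]_2)
    (Au : is_Au u)
    (AA : cstarAlgType R) (i1 i2 : {lrmorphism A -> AA})
    (AAmin : is_min_tensor i1 i2)
    (delta : {lrmorphism A -> AA})
    (deltaP : is_comultiplication i1 i2 delta u) :
  (forall r_ba : 'M[A]_3,
     is_minus_trivial i1 i2 delta (tensmx (conj_mx u) u) r_ba ->
     (forall a b, coefficients r_ba a -> coefficients r_ba b -> a * b = b * a) /\
     isomorphic_to_C (cstar_generated (coefficients r_ba)) (set_type (SO3 R))) /\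
  (forall r_ab : 'M[A]_3,
     is_minus_trivial i1 i2 delta (tensmx u (conj_mx u)) r_ab ->
     (forall a b, coefficients r_ab a -> coefficients r_ab b -> a * b = b * a) /\
     isomorphic_to_C (cstar_generated (coefficients r_ab)) (set_type (SO3 R))).
Proof.
split=> r [_ [S SU wS]]; first exact: (rep_coefficients Au SU wS).
(* Writing [u] as the conjugate of [conj_mx u] turns the tensor product into the one already
   treated. *)
have Au' := is_Au_conj Au; rewrite -[X in tensmx X _](conj_mxK u) in wS.
exact: (rep_coefficients Au' SU wS).
Qed.
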